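(* Let $A$ be a $C^*$-algebra, $J\subset A$ an essential ideal, and $M$ a Hilbert $C^*$-module over $A$. Let $\underline{\alpha}:\mathbb B_J(M)\to\mathbb B^*(M_J)$ be the map $T\mapsto\underline T=T|_{M_J}$, and let $\alpha:\mathbb B^*(M^J)\to\mathbb B^*(M_J)$ be the restriction map $R\mapsto R|_{M_J}$. Then $\alpha$ and $\underline{\alpha}$ are isometric injective homomorphisms.
   Context: Ideals are closed two-sided; $J$ essential means $aJ=0\Rightarrow a=0$ for $a\in A$. Inner products are $A$-linear in the second variable. $\mathbb B(M)$ is the Banach algebra of bounded $A$-linear maps $M\to M$ (operator norm), and $\mathbb B^*(L)$ is the $C^*$-algebra of adjointable operators on a Hilbert $C^*$-module $L$ (operators $R$ admitting $R^*$ with $\langle R^*k,l\rangle=\langle k,Rl\rangle$). $M'$ is the set of bounded linear maps $f:M\to A$ with $f(ma)=a^*f(m)$, a right $A$-module via $(fa)(m)=f(m)a$; $M$ is identified with $\widehat M\subset M'$ via $\widehat m(n)=\langle n,m\rangle$. For $T\in\mathbb B(M)$, $T^*:M'\to M'$ is $T^*(f)(m)=f(Tm)$; $T$ is $J$-adjointable if $T^*(\widehat n)x\in\widehat M$ for all $n\in M$, $x\in J$. $\mathbb B_J(M)$ is the Banach algebra of $J$-adjointable operators on $M$. $M_J$ is the norm closure of the finite sums $\sum_i m_ix_i$, $m_i\in M$, $x_i\in J$; every $T\in\mathbb B(M)$ maps $M_J$ into itself, and for $T\in\mathbb B_J(M)$ the restriction $T|_{M_J}$ is adjointable. $M_1(J)=\{f\in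 M': fx\in M\ \forall x\in J\}$. For $f,g\in M_1(J)$, $\langle g,f\rangle\in M(J)$ (multiplier algebra of $J$) is the double multiplier $(\lambda,\rho)$ with $\lambda(x)=(g(fx))^*$, $\rho(x)=f(gx^* )$, $x\in J$ ($fx,gx^*$ regarded as elements of $M$). $A$ is identified with its image under the injective map $A\to M(J)$. $M^J=\{f\in M_1(J):\langle g,f\rangle\in A\ \forall g\in M_1(J)\}$, a Hilbert $C^*$-module over $A$ containing $M$, with $(M^J)_J=M_J$, so each $R\in\mathbb B^*(M^J)$ restricts to an adjointable operator on $M_J$. *)

(* Defs.v *)
From Stdlib Require Import Reals List.
From Coquelicot Require Import Coquelicot.
Open Scope R_scope.

Record CstarAlgebra := {
  CA :> CompleteNormedModule C_AbsRing;
  cmul : CA -> CA -> CA;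
  cstar : CA -> CA;
  cmul_assoc : forall x y z, cmul (cmul x y) z = cmul x (cmul y z);
  cmul_plus_l : forall x y z, cmul (plus x y) z = plus (cmul x z) (cmul y z);
  cmul_plus_r : forall x y z, cmul x (plus y z) = plus (cmul x y) (cmul x z);
  cmul_scal_l : forall (k : C) x y, cmul (scal k x) y = scal k (cmul x y);
  cmul_scal_r : forall (k : C) x y, cmul x (scal k y) = scal k (cmul x y);
  cstar_invol : forall x, cstar (cstar x) = x;
  cstar_plus : forall x y, cstar (plus x y) = plus (cstar x) (cstar y);
  cstar_scal : forall (k : C) x, cstar (scal k x) = scal (Cconj k) (cstar x);
  cstar_cmul : forall x y, cstar (cmul x y) = cmul (cstar y) (cstar x);
  norm_cmul : forall x y, norm (cmul x y) <= norm x * norm y;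
  norm_cstar_id : forall x, norm (cmul (cstar x) x) = norm x * norm x
}.

Definition closed_ideal (A : CstarAlgebra) (J : A -> Prop) : Prop :=
  J zero /\
  (forall x y, J x -> J y -> J (plus x y)) /\
  (forall (k : C) x, J x -> J (scal k x)) /\
  (forall a x, J x -> J (cmul A a x) /\ J (cmul A x a)) /\
  (forall (u : nat -> A) (l : A),
      (forall n, J (u n)) -> filterlim u eventually (locally l) -> J l).

Definition essential_ideal (A : CstarAlgebra) (J : A -> Prop) : Prop :=
  closed_ideal A J /\
  (forall a : A, (forall x, J x -> cmul A a x = zero) -> a = zero).

(* Hilbert C*-modules over A (right modules, inner product A-linear in *)
(* the second variable); positivity <m,m> >= 0 is written <m,m> = b*b. *)
Record HilbertModule (A : CstarAlgebra) := {
  HM :> ModuleSpace C_Ring;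
  ract : HM -> A -> HM;
  ip : HM -> HM -> A;
  ract_plus_l : forall m n a, ract (plus m n) a = plus (ract m a) (ract n a);
  ract_plus_r : forall m a b, ract m (plus a b) = plus (ract m a) (ract m b);
  ract_scal_l : forall (k : C) m a, ract (scal k m) a = scal k (ract m a);
  ract_scal_r : forall (k : C) m a, ract m (scal k a) = scal k (ract m a);
  ract_cmul : forall m a b, ract (ract m a) b = ract m (cmul A a b);
  ip_plus_r : forall m n n', ip m (plus n n') = plus (ip m n) (ip m n');
  ip_scal_r : forall (k : C) m n, ip m (scal k n) = scal k (ip m n);
  ip_ract_r : forall m n a, ip m (ract n a) = cmul A (ip m n) a;
  ip_sym : forall m n, ip n m = cstar A (ip m n);
  ip_pos : forall m, exists b, ip m m = cmul A (cstar A b) b;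
  ip_definite : forall m, ip m m = zero -> m = zero;
  hm_complete : forall u : nat -> HM,
    (forall eps, 0 < eps -> exists N, forall p q, (N <= p)%nat -> (N <= q)%nat ->
        sqrt (norm (ip (minus (u p) (u q)) (minus (u p) (u q)))) < eps) ->
    exists l, forall eps, 0 < eps -> exists N, forall p, (N <= p)%nat ->
        sqrt (norm (ip (minus (u p) l) (minus (u p) l))) < eps
}.
Arguments ract {A} _ _ _.
Arguments ip {A} _ _ _.

Section Defs.
Context {A : CstarAlgebra} (J : A -> Prop) (M : HilbertModule A).

Definition Mnorm (m : M) : R := sqrt (norm (ip M m m)).

Definition MJspan (m : M) : Prop :=
  exists l : list (M * A)%type, List.Forall (fun p => J (snd p)) l /\
    m = fold_right (fun p s => plus (ract M (fst p) (snd p)) s) zero l.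
Definition MJ (m : M) : Prop :=
  forall eps, 0 < eps -> exists m', MJspan m' /\ Mnorm (minus m m') < eps.

Definition BM (T : M -> M) : Prop :=
  (forall m n, T (plus m n) = plus (T m) (T n)) /\
  (forall (k : C) m, T (scal k m) = scal k (T m)) /\
  (forall m a, T (ract M m a) = ract M (T m) a) /\
  (exists c, forall m, Mnorm (T m) <= c * Mnorm m).

Definition opnorm_on (S : M -> Prop) (T : M -> M) : Rbar :=
  Lub_Rbar (fun r => exists m, S m /\ Mnorm m <= 1 /\ r = Mnorm (T m)).

Definition in_Mdual (f : M -> A) : Prop :=
  (forall m n, f (plus m n) = plus (f m) (f n)) /\
  (forall (k : C) m, f (scal k m) = scal (Cconj k) (f m)) /\
  (forall m a, f (ract M m a) = cmul A (cstar A a) (f m)) /\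
  (exists c, forall m, norm (f m) <= c * Mnorm m).

Definition hat (m : M) : M -> A := fun n => ip M n m.

(* J-adjointable operators: T^*(\hat n) x lies in \hat M *)
Definition J_adjointable (T : M -> M) : Prop :=
  forall (n : M) (x : A), J x ->
    exists m : M, forall k, cmul A (ip M (T k) n) x = ip M k m.

Definition BJ (T : M -> M) : Prop := BM T /\ J_adjointable T.

Definition M1 (f : M -> A) : Prop :=
  in_Mdual f /\
  forall x, J x -> exists m : M, forall k, cmul A (f k) x = ip M k m.

(* <g, f> = a (a in A, viewed in M(J)): the double multiplier
   (lambda, rho), lambda(x) = (g(fx))^*, rho(x) = f(g x^* ), equals
   (x |-> a x, x |-> x a). *)
Definition ipJ_is (g f : M -> A) (a : A) : Prop :=
  forall x, J x -> forall m1 m2 : M,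
    (forall k, cmul A (f k) x = ip M k m1) ->
    (forall k, cmul A (g k) (cstar A x) = ip M k m2) ->
    cmul A a x = cstar A (g m1) /\ cmul A x a = f m2.

Definition MupJ (f : M -> A) : Prop :=
  M1 f /\ forall g, M1 g -> exists a, ipJ_is g f a.

Definition adjointable_MupJ (R : (M -> A) -> (M -> A)) : Prop :=
  (forall f, MupJ f -> MupJ (R f)) /\
  exists Rs : (M -> A) -> (M -> A),
    (forall f, MupJ f -> MupJ (Rs f)) /\
    forall k l, MupJ k -> MupJ l ->
      forall a, ipJ_is (Rs k) l a <-> ipJ_is k (R l) a.

Definition opnorm_MupJ (R : (M -> A) -> (M -> A)) : Rbar :=
  Lub_Rbar (fun r => exists f a b, MupJ f /\ ipJ_is f f a /\
              sqrt (norm a) <= 1 /\ ipJ_is (R f) (R f) b /\ r = sqrt (norm b)).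

Definition adjointable_on_MJ (S : M -> M) : Prop :=
  exists Ss : M -> M, (forall m, MJ m -> MJ (Ss m)) /\
    forall k l, MJ k -> MJ l -> ip M (Ss k) l = ip M k (S l).

Definition restrictsB (T S : M -> M) : Prop :=
  forall m, MJ m -> MJ (S m) /\ S m = T m.

Definition restrictsUp (R : (M -> A) -> (M -> A)) (S : M -> M) : Prop :=
  forall m, MJ m -> MJ (S m) /\ R (hat m) = hat (S m).

Definition opadd (T1 T2 : M -> M) : M -> M := fun m => plus (T1 m) (T2 m).
Definition opscal (k : C) (T : M -> M) : M -> M := fun m => scal k (T m).
Definition upadd (R1 R2 : (M -> A) -> (M -> A)) : (M -> A) -> (M -> A) :=
  fun f k => plus (R1 f k) (R2 f k).
Definition upscal (c : C) (R : (M -> A) -> (M -> A)) : (M -> A) -> (M -> A) :=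
  fun f k => scal c (R f k).

End Defs.

(* Main.v *)
Require Import Defs.
From Stdlib Require Import Reals Lra Lia List Arith.
From Stdlib Require Import FunctionalExtensionality ProofIrrelevance IndefiniteDescription Classical.
From Coquelicot Require Import Coquelicot.
Open Scope R_scope.

(* Let [F m k] be [<T k, m>], respectively [<k, R m>]. It is additive in both
   variables and separately bounded, hence bounded, and for [x] in [J] the
   functional [F (m x) = F m x] is represented by an element of [M], which lies in
   [M_J] because [J] has approximate units. By continuity [F m] is represented in
   [M_J] for every [m] in [M_J]; this gives the adjoint of the restriction of [T],
   and the restriction of [R] together with its adjoint.

   Isometry reduces to the fact that an essential ideal is norming:
   [|b| = sup |b x|] over the unit ball of [J]. For [f] in [M^J] and [x] in [J], the
   element [f x] is in [M_J], and [x^* <f, f> x] is its square. This fact and the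
   Cauchy-Schwarz inequality need positivity in C*-algebras, in particular of
   [x^* x], which is obtained without spectral theory from the square roots
   [sqrt (1 - q)] of self-adjoint [q] of norm at most 1. *)

(** Two obstacles shape the development. First, [A] may have no unit, so every formula containing
    [1] is computed in the multiplier algebra of [A] (not of [J]), into which [A] embeds
    isometrically by [lmult]. Second, functional calculus has to be replaced. The condition [upos]
    is a bare norm estimate, each square root comes with the clause that it commutes with whatever
    commutes with its square, and inequalities between scalar functions become inductions on
    commuting positive elements. The usual proof that essential ideals are norming compares spectra;
    here the growth of powers takes that role.

    On the module side, [M^J] is never built as a module: its inner product is the relation
    [ipJ_is], and [ipJ_unique] turns pairings into equations. An adjointable [R] is given neither as
    linear nor as bounded. All that is known is its pairing with the adjoint, which is why the bound
    on [F] has to come from a uniform boundedness argument. *)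

(** * Unital C*-algebras *)

(* Scalars are real; the imaginary unit is the central element [uim]. The
   intended instance is the multiplier algebra of a [CstarAlgebra]. *)
Record UCstar := {
  uc :> Type;
  u0 : uc; u1 : uc; uim : uc;
  uadd : uc -> uc -> uc;
  uopp : uc -> uc;
  umul : uc -> uc -> uc;
  uscal : R -> uc -> uc;
  ustar : uc -> uc;
  unorm : uc -> R;
  uaddC : forall x y, uadd x y = uadd y x;
  uaddA : forall x y z, uadd x (uadd y z) = uadd (uadd x y) z;
  uadd0 : forall x, uadd x u0 = x;
  uaddN : forall x, uadd x (uopp x) = u0;
  umulA : forall x y z, umul x (umul y z) = umul (umul x y) z;
  umul1l : forall x, umul u1 x = x;
  umul1r : forall x, umul x u1 = x;
  umulDl : forall x y z, umul (uadd x y) z = uadd (umul x z) (umul y z);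
  umulDr : forall x y z, umul x (uadd y z) = uadd (umul x y) (umul x z);
  uscal1 : forall x, uscal 1 x = x;
  uscalDl : forall a b x, uscal (a + b) x = uadd (uscal a x) (uscal b x);
  uscalDr : forall a x y, uscal a (uadd x y) = uadd (uscal a x) (uscal a y);
  uscalA : forall a b x, uscal a (uscal b x) = uscal (a * b) x;
  uscalMl : forall a x y, umul (uscal a x) y = uscal a (umul x y);
  uscalMr : forall a x y, umul x (uscal a y) = uscal a (umul x y);
  ustarK : forall x, ustar (ustar x) = x;
  ustarD : forall x y, ustar (uadd x y) = uadd (ustar x) (ustar y);
  ustarM : forall x y, ustar (umul x y) = umul (ustar y) (ustar x);
  ustarZ : forall a x, ustar (uscal a x) = uscal a (ustar x);
  uim_sq : umul uim uim = uopp u1;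
  uim_star : ustar uim = uopp uim;
  uim_comm : forall x, umul uim x = umul x uim;
  unormD : forall x y, unorm (uadd x y) <= unorm x + unorm y;
  unormM : forall x y, unorm (umul x y) <= unorm x * unorm y;
  unormZ_le : forall a x, unorm (uscal a x) <= Rabs a * unorm x;
  unorm_ge0 : forall x, 0 <= unorm x;
  unorm_eq0 : forall x, unorm x = 0 -> x = u0;
  unorm_Cstar : forall x, unorm (umul (ustar x) x) = unorm x * unorm x;
  ucomplete : forall u : nat -> uc,
    (forall eps, 0 < eps -> exists N, forall p q, (N <= p)%nat -> (N <= q)%nat ->
        unorm (uadd (u p) (uopp (u q))) < eps) ->
    exists l, forall eps, 0 < eps -> exists N, forall p, (N <= p)%nat ->
        unorm (uadd (u p) (uopp l)) < eps
}.

Arguments u0 {_}. Arguments u1 {_}. Arguments uim {_}.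
Arguments uadd {_} _ _. Arguments uopp {_} _. Arguments umul {_} _ _.
Arguments uscal {_} _ _. Arguments ustar {_} _. Arguments unorm {_} _.

Declare Scope U_scope.
Delimit Scope U_scope with U.
Notation "x + y" := (uadd x y) : U_scope.
Notation "x * y" := (umul x y) : U_scope.
Notation "- x" := (uopp x) : U_scope.
Notation "x - y" := (uadd x (uopp y)) : U_scope.
Notation "c *: x" := (uscal c x) (at level 40) : U_scope.
Notation "x ^*" := (ustar x) (at level 2, format "x ^*") : U_scope.
Notation "0" := u0 : U_scope.
Notation "1" := u1 : U_scope.
Bind Scope U_scope with uc.

Definition ucomm {U : UCstar} (x y : U) : Prop := (x * y)%U = (y * x)%U.

(** * Noncommutative polynomial identities by reflection *)

Section Normalisation.
Context {U : UCstar}.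
Implicit Types x y z : U.

Lemma uadd0l x : (0 + x)%U = x.
Proof. now rewrite uaddC, uadd0. Qed.

Lemma uadd_cancel x y z : (x + y = x + z)%U -> y = z.
Proof.
  intro H. rewrite <- (uadd0l y), <- (uadd0l z), <- (uaddN _ x).
  rewrite (uaddC _ x (- x)%U), <- !uaddA. now rewrite H.
Qed.

Lemma uscal0 x : (0%R *: x)%U = u0.
Proof.
  apply (uadd_cancel (0%R *: x)%U). now rewrite <- uscalDl, Rplus_0_r, uadd0.
Qed.

Lemma uscal0r a : (a *: (0 : U))%U = u0.
Proof.
  rewrite <- (uscal0 (u0 : U)), uscalA. now rewrite Rmult_0_r.
Qed.

Lemma uscalN1 x : ((-1)%R *: x)%U = (- x)%U.
Proof.
  apply (uadd_cancel x). rewrite uaddN.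
  rewrite <- (uscal1 _ x) at 1. rewrite <- uscalDl.
  replace (1 + -1) with 0 by ring. apply uscal0.
Qed.

Lemma umul0l x : (0 * x)%U = u0.
Proof. rewrite <- (uscal0 u0), uscalMl, !uscal0. reflexivity. Qed.

Lemma umul0r x : (x * 0)%U = u0.
Proof. rewrite <- (uscal0 u0), uscalMr, !uscal0. reflexivity. Qed.

Inductive uexpr :=
  | EO | EI | EA (n : nat) | EP (a b : uexpr) | EM (a b : uexpr)
  | EN (a : uexpr) | EZ (c : R) (a : uexpr).

Fixpoint nthU (env : list U) (n : nat) : U :=
  match env, n with
  | nil, _ => u0
  | x :: _, O => x
  | _ :: t, S n => nthU t n
  end.

Fixpoint ueval (env : list U) (e : uexpr) : U :=
  match e with
  | EO => u0 | EI => u1 | EA n => nthU env n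
  | EP a b => (ueval env a + ueval env b)%U
  | EM a b => (ueval env a * ueval env b)%U
  | EN a => (- ueval env a)%U
  | EZ c a => (c *: ueval env a)%U
  end.

Fixpoint weval (env : list U) (w : list nat) : U :=
  match w with nil => u1 | n :: w => (nthU env n * weval env w)%U end.

Fixpoint leval (env : list U) (l : list (R * list nat)) : U :=
  match l with nil => u0 | (c, w) :: l => (c *: weval env w + leval env l)%U end.

(** Private copies of append and of the comparisons on [nat] let [u_compute] unfold a fixed list of
    names and leave the real coefficients untouched. *)
Fixpoint lapp (l l' : list (R * list nat)) :=
  match l with nil => l' | t :: l => t :: lapp l l' end.
Fixpoint wapp (l l' : list nat) :=
  match l with nil => l' | t :: l => t :: wapp l l' end.
Fixpoint lscal (c : R) (l : list (R * list nat)) :=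
  match l with nil => nil | (d, w) :: l => (c * d, w) :: lscal c l end.
Fixpoint lmul1 (c : R) (w : list nat) (l : list (R * list nat)) :=
  match l with nil => nil | (d, v) :: l => (c * d, wapp w v) :: lmul1 c w l end.
Fixpoint lmul (l l' : list (R * list nat)) :=
  match l with nil => nil | (c, w) :: l => lapp (lmul1 c w l') (lmul l l') end.

Fixpoint unf (e : uexpr) : list (R * list nat) :=
  match e with
  | EO => nil | EI => (1, nil) :: nil | EA n => (1, n :: nil) :: nil
  | EP a b => lapp (unf a) (unf b)
  | EM a b => lmul (unf a) (unf b)
  | EN a => lscal (-1) (unf a)
  | EZ c a => lscal c (unf a)
  end.

Fixpoint nleb (m n : nat) : bool :=
  match m, n with O, _ => true | S _, O => false | S m, S n => nleb m n end.
Fixpoint neqb (m n : nat) : bool :=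
  match m, n with O, O => true | S m, S n => neqb m n | _, _ => false end.
Fixpoint weqb (v w : list nat) : bool :=
  match v, w with
  | nil, nil => true
  | m :: v, n :: w => if neqb m n then weqb v w else false
  | _, _ => false
  end.

Fixpoint winsert (n : nat) (w : list nat) :=
  match w with
  | nil => n :: nil
  | m :: w' => if nleb n m then n :: w else m :: winsert n w'
  end.
Fixpoint wsort (w : list nat) :=
  match w with nil => nil | n :: w => winsert n (wsort w) end.
Fixpoint lsort (l : list (R * list nat)) :=
  match l with nil => nil | (c, w) :: l => (c, wsort w) :: lsort l end.

Fixpoint linsert (c : R) (w : list nat) (l : list (R * list nat)) :=
  match l with
  | nil => (c, w) :: nil
  | (d, v) :: l' => if weqb w v then (c + d, v) :: l' else (d, v) :: linsert c w l'
  end.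
Fixpoint lcollect (l : list (R * list nat)) :=
  match l with nil => nil | (c, w) :: l => linsert c w (lcollect l) end.
Fixpoint lzero (l : list (R * list nat)) : Prop :=
  match l with nil => True | (c, _) :: l => c = 0 /\ lzero l end.

Fixpoint comm_with (x : U) (env : list U) : Prop :=
  match env with nil => True | y :: t => ucomm x y /\ comm_with x t end.
Fixpoint all_comm (env : list U) : Prop :=
  match env with nil => True | x :: t => comm_with x t /\ all_comm t end.

Lemma uaddCA x y z : (x + (y + z) = y + (x + z))%U.
Proof. now rewrite uaddA, (uaddC _ x y), <- uaddA. Qed.

Lemma neqb_eq m n : neqb m n = true -> m = n.
Proof.
  revert n. induction m as [|m IH]; intros [|n]; simpl; intro H; try easy.
  now rewrite (IH n).
Qed.

Lemma weqb_eq v w : weqb v w = true -> v = w.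
Proof.
  revert w. induction v as [|m v IH]; intros [|n w]; simpl; intro H; try easy.
  destruct (neqb m n) eqn:E; [|easy]. now rewrite (neqb_eq _ _ E), (IH w).
Qed.

Lemma leval_app env l l' : leval env (lapp l l') = (leval env l + leval env l')%U.
Proof.
  induction l as [|[c w] l IH]; simpl; [now rewrite uadd0l|].
  now rewrite IH, uaddA.
Qed.

Lemma weval_app env w w' : weval env (wapp w w') = (weval env w * weval env w')%U.
Proof.
  induction w as [|n w IH]; simpl; [now rewrite umul1l|]. now rewrite IH, umulA.
Qed.

Lemma leval_scal env c l : leval env (lscal c l) = (c *: leval env l)%U.
Proof.
  induction l as [|[d w] l IH]; simpl; [now rewrite uscal0r|].
  now rewrite IH, uscalDr, uscalA.
Qed.

Lemma leval_mul1 env c w l :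
  leval env (lmul1 c w l) = ((c *: weval env w) * leval env l)%U.
Proof.
  induction l as [|[d v] l IH]; simpl; [now rewrite umul0r|].
  now rewrite IH, umulDr, weval_app, uscalMr, !uscalMl, uscalA, (Rmult_comm d).
Qed.

Lemma leval_mul env l l' : leval env (lmul l l') = (leval env l * leval env l')%U.
Proof.
  induction l as [|[c w] l IH]; simpl; [now rewrite umul0l|].
  now rewrite leval_app, IH, leval_mul1, umulDl.
Qed.

Lemma unf_correct env e : leval env (unf e) = ueval env e.
Proof.
  induction e as [| |n|a IHa b IHb|a IHa b IHb|a IHa|c a IHa]; simpl.
  - reflexivity.
  - now rewrite uscal1, uadd0.
  - now rewrite uscal1, uadd0, umul1r.
  - now rewrite leval_app, IHa, IHb.
  - now rewrite leval_mul, IHa, IHb.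
  - now rewrite leval_scal, IHa, uscalN1.
  - now rewrite leval_scal, IHa.
Qed.

Lemma leval_insert env c w l :
  leval env (linsert c w l) = (c *: weval env w + leval env l)%U.
Proof.
  induction l as [|[d v] l IH]; simpl; [reflexivity|].
  destruct (weqb w v) eqn:E; simpl.
  - rewrite (weqb_eq _ _ E), uscalDl. now rewrite uaddA.
  - now rewrite IH, uaddCA.
Qed.

Lemma leval_collect env l : leval env (lcollect l) = leval env l.
Proof.
  induction l as [|[c w] l IH]; simpl; [reflexivity|]. now rewrite leval_insert, IH.
Qed.

Lemma leval_zero env l : lzero l -> leval env l = u0.
Proof.
  induction l as [|[c w] l IH]; simpl; [reflexivity|].
  intros [-> H]. now rewrite uscal0, uadd0l, IH.
Qed.

Lemma usub_eq0 x y : (x - y)%U = u0 -> x = y.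
Proof.
  intro H. apply (uadd_cancel (- y)%U). now rewrite (uaddC _ _ x), H, uaddC, uaddN.
Qed.

Lemma ucommC x y : ucomm x y -> ucomm y x.
Proof. intro H. now symmetry. Qed.
Lemma ucomm_refl x : ucomm x x.
Proof. reflexivity. Qed.
Lemma ucomm0 x : ucomm x u0.
Proof. red. now rewrite umul0l, umul0r. Qed.

Lemma all_comm_nth env m n : all_comm env -> ucomm (nthU env m) (nthU env n).
Proof.
  assert (cw : forall x env n, comm_with x env -> ucomm x (nthU env n)).
  { intros x e. induction e as [|y t IH]; intros k H; [apply ucomm0|].
    destruct k; simpl; [apply H|apply IH, H]. }
  revert m n. induction env as [|x t IH]; intros m n H; [apply ucomm0|].
  destruct H as [H1 H2]. destruct m, n; simpl.
  - apply ucomm_refl.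
  - now apply cw.
  - apply ucommC. now apply cw.
  - now apply IH.
Qed.

Lemma weval_sort env w : all_comm env -> weval env (wsort w) = weval env w.
Proof.
  intro Hc.
  assert (ins : forall n w, weval env (winsert n w) = (nthU env n * weval env w)%U).
  { intros n v. induction v as [|m v IH]; simpl; [reflexivity|].
    destruct (nleb n m); simpl; [reflexivity|].
    rewrite IH, !umulA. f_equal. now apply all_comm_nth. }
  induction w as [|n w IH]; simpl; [reflexivity|]. now rewrite ins, IH.
Qed.

Lemma leval_sort env l : all_comm env -> leval env (lsort l) = leval env l.
Proof.
  intro Hc. induction l as [|[c w] l IH]; simpl; [reflexivity|].
  now rewrite IH, weval_sort.
Qed.

Lemma unf_eq env e1 e2 :
  lzero (lcollect (unf (EP e1 (EN e2)))) -> ueval env e1 = ueval env e2.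
Proof.
  intro H. apply usub_eq0. change (ueval env (EP e1 (EN e2)) = u0).
  rewrite <- unf_correct, <- leval_collect. now apply leval_zero.
Qed.

Lemma unf_comm_eq env e1 e2 :
  all_comm env ->
  lzero (lcollect (lsort (unf (EP e1 (EN e2))))) -> ueval env e1 = ueval env e2.
Proof.
  intros Hc H. apply usub_eq0. change (ueval env (EP e1 (EN e2)) = u0).
  rewrite <- unf_correct, <- (leval_sort env _ Hc), <- leval_collect.
  now apply leval_zero.
Qed.

End Normalisation.

Ltac u_add_atom x env :=
  let rec mem l :=
    match l with
    | nil => constr:(false)
    | ?y :: ?t => match y with x => constr:(true) | _ => mem t end
    end in
  match mem env with true => env | false => constr:(x :: env) end.

Ltac u_atoms e env :=
  match e with
  | u0 => env
  | u1 => env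
  | uadd ?a ?b => let env := u_atoms a env in u_atoms b env
  | umul ?a ?b => let env := u_atoms a env in u_atoms b env
  | uopp ?a => u_atoms a env
  | uscal _ ?a => u_atoms a env
  | _ => u_add_atom e env
  end.

Ltac u_index x env :=
  match env with
  | x :: _ => constr:(O)
  | _ :: ?t => let n := u_index x t in constr:(S n)
  end.

Ltac u_reify e env :=
  match e with
  | u0 => constr:(EO)
  | u1 => constr:(EI)
  | uadd ?a ?b => let a := u_reify a env in let b := u_reify b env in constr:(EP a b)
  | umul ?a ?b => let a := u_reify a env in let b := u_reify b env in constr:(EM a b)
  | uopp ?a => let a := u_reify a env in constr:(EN a)
  | uscal ?c ?a => let a := u_reify a env in constr:(EZ c a)
  | _ => let n := u_index e env in constr:(EA n)
  end.

Ltac u_compute :=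
  cbv [lzero lcollect linsert weqb neqb lsort wsort winsert nleb unf lmul lmul1
       lscal wapp lapp]; repeat split; try (field; lra); try ring.

Ltac u_lists tac :=
  match goal with
  | |- @eq ?T ?a ?b =>
    let env := u_atoms a (@nil T) in
    let env := u_atoms b env in
    let e1 := u_reify a env in
    let e2 := u_reify b env in
    tac env e1 e2
  end.

(* [ucring] uses no commutation; [ucomring] reduces to pairwise commutation of
   the atoms, which it leaves to the hint base [ucomm]. *)
Ltac ucring :=
  u_lists ltac:(fun env e1 e2 =>
    change (ueval env e1 = ueval env e2); apply unf_eq; u_compute).

Create HintDb ucomm.
Global Hint Resolve ucomm_refl : ucomm.
Global Hint Immediate ucommC : ucomm.

Ltac ucomring :=
  u_lists ltac:(fun env e1 e2 =>
    change (ueval env e1 = ueval env e2); apply unf_comm_eq;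
    [ cbv [all_comm comm_with]; repeat split; auto with ucomm | u_compute ]).

(** * Norm, limits and powers *)

Section Norm.
Context {U : UCstar}.
Implicit Types x y z p q h k : U.

Lemma unorm0 : unorm (0 : U)%U = 0.
Proof.
  apply Rle_antisym; [|apply unorm_ge0].
  rewrite <- (uscal0 (u0 : U)). eapply Rle_trans; [apply unormZ_le|].
  rewrite Rabs_R0. lra.
Qed.

Lemma unormZ a x : unorm (a *: x)%U = Rabs a * unorm x.
Proof.
  apply Rle_antisym; [apply unormZ_le|].
  destruct (Req_dec a 0) as [->|Ha].
  - rewrite Rabs_R0, Rmult_0_l. apply unorm_ge0.
  - assert (E : x = (/ a *: (a *: x))%U) by ucring.
    assert (L : unorm x <= Rabs (/ a) * unorm (a *: x)%U)
      by (rewrite E at 1; apply unormZ_le).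
    rewrite Rabs_inv in L.
    apply Rmult_le_reg_l with (/ Rabs a); [now apply Rinv_0_lt_compat, Rabs_pos_lt|].
    rewrite <- Rmult_assoc, Rinv_l, Rmult_1_l; [exact L|now apply Rabs_no_R0].
Qed.

Lemma unormN x : unorm (- x)%U = unorm x.
Proof. rewrite <- uscalN1, unormZ, Rabs_left; lra. Qed.

Lemma unormB x y : unorm (x - y)%U <= unorm x + unorm y.
Proof. rewrite <- (unormN y). apply unormD. Qed.

Lemma unormBC x y : unorm (x - y)%U = unorm (y - x)%U.
Proof. rewrite <- unormN. f_equal. ucring. Qed.

Lemma unorm_star x : unorm (x^*)%U = unorm x.
Proof.
  assert (le : forall y, unorm y <= unorm (y^*)%U).
  { intro y. destruct (unorm_ge0 U y) as [P|P].
    - apply Rmult_le_reg_r with (unorm y); [easy|].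
      rewrite <- unorm_Cstar. apply unormM.
    - rewrite <- P. apply unorm_ge0. }
  apply Rle_antisym; [|apply le]. rewrite <- (ustarK _ x) at 2. apply le.
Qed.

Lemma unorm_small x : (forall eps, 0 < eps -> unorm x <= eps) -> x = u0.
Proof.
  intro H. apply unorm_eq0, Rle_antisym; [|apply unorm_ge0].
  apply le_epsilon. intros e He. rewrite Rplus_0_l. now apply H.
Qed.

Lemma ustar1 : ((1 : U)^*)%U = u1.
Proof.
  rewrite <- (ustarK U u1) at 2. rewrite <- (umul1r U (u1^*)%U) at 2.
  now rewrite ustarM, ustarK, umul1r.
Qed.

Lemma ustar0 : ((0 : U)^*)%U = u0.
Proof. rewrite <- (uscal0 (u0 : U)), ustarZ. now rewrite !uscal0. Qed.

Lemma ustarN x : ((- x)^*)%U = (- x^*)%U.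
Proof. now rewrite <- !uscalN1, ustarZ. Qed.

(** Only an inequality, since the algebra may be zero. *)
Lemma unorm1 : unorm (1 : U) <= 1.
Proof.
  pose proof (unorm_Cstar U u1) as H. rewrite ustar1, umul1r in H.
  pose proof (unorm_ge0 U u1). nra.
Qed.

Lemma unorm_const a : 0 <= a -> unorm (a *: (1 : U))%U <= a.
Proof.
  intro Ha. rewrite unormZ, Rabs_pos_eq by easy. pose proof unorm1. nra.
Qed.

Lemma unorm_selfadj_sq h : (h^*)%U = h -> unorm (h * h)%U = unorm h * unorm h.
Proof. intro H. now rewrite <- unorm_Cstar, H. Qed.

Lemma ucommD x y z : ucomm x y -> ucomm x z -> ucomm x (y + z)%U.
Proof. unfold ucomm. intros. rewrite umulDl, umulDr. congruence. Qed.
Lemma ucommZ a x y : ucomm x y -> ucomm x (a *: y)%U.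
Proof. unfold ucomm. intro H. now rewrite uscalMl, uscalMr, H. Qed.
Lemma ucommN x y : ucomm x y -> ucomm x (- y)%U.
Proof. rewrite <- uscalN1. apply ucommZ. Qed.
Lemma ucommM x y z : ucomm x y -> ucomm x z -> ucomm x (y * z)%U.
Proof. unfold ucomm. intros H1 H2. now rewrite umulA, H1, <- !umulA, H2. Qed.
Lemma ucomm1 x : ucomm x u1.
Proof. red. now rewrite umul1l, umul1r. Qed.
Lemma ucomm_im x : ucomm x uim.
Proof. red. now rewrite uim_comm. Qed.

Definition ulim (u : nat -> U) (l : U) : Prop :=
  forall eps, 0 < eps -> exists N, forall n, (N <= n)%nat -> unorm (u n - l)%U < eps.

Lemma ulim_const x : ulim (fun _ => x) x.
Proof. intros e He. exists O. intros. rewrite uaddN, unorm0. easy. Qed.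

Lemma ulim_unique u l m : ulim u l -> ulim u m -> l = m.
Proof.
  intros Hl Hm. apply usub_eq0, unorm_small. intros e He.
  destruct (Hl (e / 2)) as [N HN]; [lra|]. destruct (Hm (e / 2)) as [N' HN']; [lra|].
  specialize (HN (N + N')%nat ltac:(lia)). specialize (HN' (N + N')%nat ltac:(lia)).
  replace (l - m)%U with ((u (N + N')%nat - m) - (u (N + N')%nat - l))%U by ucring.
  eapply Rle_trans; [apply unormB|]. lra.
Qed.

Lemma ulim_add u v l m : ulim u l -> ulim v m -> ulim (fun n => u n + v n)%U (l + m)%U.
Proof.
  intros Hl Hm e He.
  destruct (Hl (e / 2)) as [N HN]; [lra|]. destruct (Hm (e / 2)) as [N' HN']; [lra|].
  exists (N + N')%nat. intros n Hn.
  specialize (HN n ltac:(lia)). specialize (HN' n ltac:(lia)).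
  replace (u n + v n - (l + m))%U with ((u n - l) + (v n - m))%U by ucring.
  eapply Rle_lt_trans; [apply unormD|]. lra.
Qed.

Lemma ulim_star u l : ulim u l -> ulim (fun n => (u n)^*)%U (l^*)%U.
Proof.
  intros Hl e He. destruct (Hl e He) as [N HN]. exists N. intros n Hn.
  rewrite <- ustarN, <- ustarD, unorm_star. now apply HN.
Qed.

Lemma ulim_mul u v l m : ulim u l -> ulim v m -> ulim (fun n => u n * v n)%U (l * m)%U.
Proof.
  intros Hl Hm e He.
  pose proof (unorm_ge0 U l). pose proof (unorm_ge0 U m).
  assert (P : forall a, 0 <= a -> 0 < e / (2 * (a + 1)))
    by (intros; apply Rdiv_lt_0_compat; lra).
  destruct (Hl (e / (2 * (unorm m + 1 + 1)))) as [N HN]; [apply P; lra|].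
  destruct (Hm (Rmin 1 (e / (2 * (unorm l + 1))))) as [N' HN'].
  { apply Rmin_case; [lra|now apply P]. }
  exists (N + N')%nat. intros n Hn.
  specialize (HN n ltac:(lia)). specialize (HN' n ltac:(lia)).
  pose proof (Rmin_l 1 (e / (2 * (unorm l + 1)))).
  pose proof (Rmin_r 1 (e / (2 * (unorm l + 1)))).
  replace (u n * v n - l * m)%U with ((u n - l) * v n + l * (v n - m))%U by ucring.
  eapply Rle_lt_trans; [apply unormD|].
  assert (V : unorm (v n) <= unorm m + 1).
  { replace (v n) with ((v n - m) + m)%U by ucring.
    eapply Rle_trans; [apply unormD|]. lra. }
  pose proof (unormM U (u n - l)%U (v n)). pose proof (unormM U l (v n - m)%U).
  pose proof (unorm_ge0 U (u n - l)%U). pose proof (unorm_ge0 U (v n - m)%U).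
  assert (A1 : unorm (u n - l)%U * unorm (v n) < e / 2).
  { apply Rle_lt_trans with (unorm (u n - l)%U * (unorm m + 1)); [nra|].
    apply Rle_lt_trans with (e / (2 * (unorm m + 1 + 1)) * (unorm m + 1)); [nra|].
    apply Rmult_lt_reg_r with (2 * (unorm m + 1 + 1)); [lra|]. field_simplify; nra. }
  assert (A2 : unorm l * unorm (v n - m)%U <= e / 2).
  { apply Rle_trans with (unorm l * (e / (2 * (unorm l + 1)))); [nra|].
    apply Rmult_le_reg_r with (2 * (unorm l + 1)); [lra|]. field_simplify; nra. }
  lra.
Qed.

Lemma ulim_scal a u l : ulim u l -> ulim (fun n => a *: u n)%U (a *: l)%U.
Proof.
  intros Hl e He.
  pose proof (Rabs_pos a).
  destruct (Hl (e / (Rabs a + 1))) as [N HN]; [apply Rdiv_lt_0_compat; lra|].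
  exists N. intros n Hn. specialize (HN n Hn).
  replace (a *: u n - a *: l)%U with (a *: (u n - l))%U by ucring.
  rewrite unormZ. pose proof (unorm_ge0 U (u n - l)%U).
  apply Rle_lt_trans with ((Rabs a) * (e / (Rabs a + 1))); [nra|].
  apply Rmult_lt_reg_r with (Rabs a + 1); [lra|]. field_simplify; lra.
Qed.

Lemma ulim_shift u l : ulim u l -> ulim (fun n => u (S n)) l.
Proof.
  intros Hl e He. destruct (Hl e He) as [N HN]. exists N. intros n Hn. apply HN. lia.
Qed.

Lemma ulim_norm_le u l c : ulim u l -> (forall n, unorm (u n) <= c) -> unorm l <= c.
Proof.
  intros Hl H. apply le_epsilon. intros e He.
  destruct (Hl e He) as [N HN]. specialize (HN N (le_n _)). specialize (H N).
  replace l with (u N - (u N - l))%U by ucring.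
  eapply Rle_trans; [apply unormB|]. lra.
Qed.

Lemma ulim_ext u v l : (forall n, u n = v n) -> ulim u l -> ulim v l.
Proof. intros E H e He. destruct (H e He) as [N HN]. exists N. intros. rewrite <- E. auto. Qed.

Fixpoint upow x (n : nat) : U :=
  match n with O => u1 | S n => (x * upow x n)%U end.

Lemma ucomm_pow x y n : ucomm x y -> ucomm x (upow y n).
Proof. intro H. induction n; simpl; [apply ucomm1|now apply ucommM]. Qed.

Lemma upow_star x n : (x^*)%U = x -> ((upow x n)^*)%U = upow x n.
Proof.
  intro H. induction n as [|n IH]; simpl; [apply ustar1|].
  rewrite ustarM, IH, H. symmetry. apply ucomm_pow, ucomm_refl.
Qed.

Lemma upow_add x m n : upow x (m + n) = (upow x m * upow x n)%U.
Proof. induction m as [|m IH]; simpl; [now rewrite umul1l|]. now rewrite IH, umulA. Qed.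

End Norm.

Global Hint Resolve ucommD ucommZ ucommN ucommM ucomm1 ucomm_im ucomm_pow : ucomm.
Global Hint Extern 1 (ucomm uim _) => apply uim_comm : ucomm.
Global Hint Rewrite @ustarD @ustarM @ustarZ @ustarK @ustarN @ustar0 @ustar1 uim_star : ustar.

(** * Square roots and positivity *)

(** A fixed point [s] satisfies [(1 - s)^2 = 1 - q], so the limit is [1 - sqrt (1 - q)]. *)
Fixpoint usqrt_iter {U : UCstar} (q : U) (n : nat) : U :=
  match n with
  | O => u0
  | S n => (/ 2 *: (q + usqrt_iter q n * usqrt_iter q n))%U
  end.

(** The case [q = 1] in the reals: increasing and bounded by 1, hence convergent. It majorises the
    iteration for every [q] of norm at most 1. *)
Fixpoint rsqrt_iter (n : nat) : R :=
  match n with O => 0 | S n => (1 + rsqrt_iter n * rsqrt_iter n) / 2 end.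

Lemma rsqrt_iter_bounds n : 0 <= rsqrt_iter n <= 1.
Proof. induction n as [|n IH]; simpl; nra. Qed.

Lemma rsqrt_iter_cauchy : Cauchy_crit rsqrt_iter.
Proof.
  destruct (Un_cv_crit rsqrt_iter) as [l Hl].
  - intro n. induction n as [|n IH]; simpl; [lra|].
    pose proof (rsqrt_iter_bounds n). simpl in IH. nra.
  - exists 1. intros x [n ->]. apply rsqrt_iter_bounds.
  - apply CV_Cauchy. now exists l.
Qed.

Section Positive.
Context {U : UCstar}.
Implicit Types x y z p q h k : U.

Lemma usqrt_iter_norm q n : unorm q <= 1 -> unorm (usqrt_iter q n) <= rsqrt_iter n.
Proof.
  intro Hq. induction n as [|n IH]; simpl; [rewrite unorm0; lra|].
  rewrite unormZ, Rabs_pos_eq by lra.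
  pose proof (unormD U q (usqrt_iter q n * usqrt_iter q n)%U).
  pose proof (unormM U (usqrt_iter q n) (usqrt_iter q n)).
  pose proof (unorm_ge0 U (usqrt_iter q n)). nra.
Qed.

(* The increments of the iteration are dominated by those of the scalar
   iteration for [q = 1], because its terms are polynomials in [q] with
   nonnegative coefficients. *)
Lemma usqrt_iter_incr q n j : unorm q <= 1 ->
  unorm (usqrt_iter q (n + j) - usqrt_iter q n)%U <= rsqrt_iter (n + j) - rsqrt_iter n.
Proof.
  intro Hq. induction n as [|n IH]; simpl.
  - rewrite Rminus_0_r.
    replace (usqrt_iter q j - 0)%U with (usqrt_iter q j) by ucring.
    now apply usqrt_iter_norm.
  - pose proof (usqrt_iter_norm q (n + j) Hq) as Na.
    pose proof (usqrt_iter_norm q n Hq) as Nb.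
    set (a := usqrt_iter q (n + j)) in *. set (b := usqrt_iter q n) in *.
    replace (/ 2 *: (q + a * a) - / 2 *: (q + b * b))%U
      with (/ 2 *: (a * (a - b) + (a - b) * b))%U by ucring.
    rewrite unormZ, Rabs_pos_eq by lra.
    pose proof (unormD U (a * (a - b))%U ((a - b) * b)%U).
    pose proof (unormM U a (a - b)%U). pose proof (unormM U (a - b)%U b).
    pose proof (unorm_ge0 U a). pose proof (unorm_ge0 U b).
    pose proof (unorm_ge0 U (a - b)%U).
    assert (unorm a * unorm (a - b)%U + unorm (a - b)%U * unorm b
        <= (rsqrt_iter (n + j) - rsqrt_iter n) * (rsqrt_iter (n + j) + rsqrt_iter n)) by nra.
    nra.
Qed.

(* Says that the spectrum is nonnegative, without mentioning spectra. *)
Definition upos p : Prop := (p^*)%U = p /\ exists t, unorm (t *: 1 - p)%U <= t.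

(** Take [k = 1 - s] with [s] the limit of the iteration. The scalar majorant gives [|s| <= 1],
    which is [upos k] with [t = 1]. The commutation clause holds because [s] is a limit of
    polynomials in [q]. *)
Lemma usqrt1 q : (q^*)%U = q -> unorm q <= 1 ->
  exists k, upos k /\ (k * k)%U = (1 - q)%U /\ forall c, ucomm c q -> ucomm c k.
Proof.
  intros Hs Hq.
  destruct (ucomplete U (usqrt_iter q)) as [s Hlim].
  { intros e He. destruct (rsqrt_iter_cauchy e He) as [N HN].
    assert (W : forall m n, (N <= n)%nat -> (n <= m)%nat ->
      unorm (usqrt_iter q m - usqrt_iter q n)%U < e).
    { intros m n Hn Hm. replace m with (n + (m - n))%nat by lia.
      eapply Rle_lt_trans; [now apply usqrt_iter_incr|].
      specialize (HN (n + (m - n))%nat n ltac:(lia) ltac:(lia)).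
      unfold Rdist in HN. pose proof (Rle_abs (rsqrt_iter (n + (m - n)) - rsqrt_iter n)).
      lra. }
    exists N. intros m n Hm Hn. destruct (Nat.le_ge_cases n m) as [L|L].
    - now apply W.
    - rewrite unormBC. now apply W. }
  change (ulim (usqrt_iter q) s) in Hlim.
  assert (Es : s = (/ 2 *: (q + s * s))%U).
  { apply (ulim_unique (fun n => usqrt_iter q (S n))); [now apply ulim_shift|].
    simpl. apply ulim_scal, ulim_add; [apply ulim_const|]. now apply ulim_mul. }
  assert (Ss : (s^*)%U = s).
  { apply (ulim_unique (usqrt_iter q)); [|easy].
    apply ulim_ext with (fun n => (usqrt_iter q n)^*)%U; [|now apply ulim_star].
    intro n. induction n as [|n IH]; simpl; autorewrite with ustar; [easy|].
    now rewrite IH, Hs. }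
  exists (1 - s)%U. split; [|split].
  - split; [now autorewrite with ustar; rewrite Ss|]. exists 1.
    replace (1%R *: 1 - (1 - s))%U with s by ucring.
    apply (ulim_norm_le (usqrt_iter q)); [easy|]. intro n.
    eapply Rle_trans; [now apply usqrt_iter_norm|]. apply rsqrt_iter_bounds.
  - assert (E2 : (s * s)%U = (2 *: s - q)%U) by (rewrite Es at 3; ucring).
    transitivity (1 - 2 *: s + s * s)%U; [ucring|]. rewrite E2. ucring.
  - intros c Hc. apply ucommD; [apply ucomm1|apply ucommN].
    apply (ulim_unique (fun n => c * usqrt_iter q n)%U).
    + apply ulim_mul; [apply ulim_const|easy].
    + apply ulim_ext with (fun n => usqrt_iter q n * c)%U.
      * intro n. apply ucommC. induction n as [|n IH]; simpl; auto with ucomm.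
        apply ucomm0.
      * apply ulim_mul; [easy|apply ulim_const].
Qed.

Lemma upos_scal a p : 0 <= a -> upos p -> upos (a *: p)%U.
Proof.
  intros Ha [Hs [t Ht]]. split; [now rewrite ustarZ, Hs|]. exists (a * t).
  replace ((a * t) *: 1 - a *: p)%U with (a *: (t *: 1 - p))%U by ucring.
  rewrite unormZ, Rabs_pos_eq by easy. nra.
Qed.

Lemma upos_add p q : upos p -> upos q -> upos (p + q)%U.
Proof.
  intros [Hp [t Ht]] [Hq [t' Ht']]. split; [now rewrite ustarD, Hp, Hq|].
  exists (t + t').
  replace ((t + t')%R *: 1 - (p + q))%U with ((t *: 1 - p) + (t' *: 1 - q))%U by ucring.
  eapply Rle_trans; [apply unormD|]. lra.
Qed.

Lemma upos_const a : 0 <= a -> upos (a *: 1)%U.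
Proof.
  intro Ha. split; [now autorewrite with ustar|]. exists a. rewrite uaddN, unorm0. easy.
Qed.

Lemma upos1 : upos 1%U.
Proof. rewrite <- (uscal1 U u1). apply upos_const. lra. Qed.

Lemma upos0 : upos 0%U.
Proof. rewrite <- (uscal0 u0). apply (upos_scal 0 0%U); [lra|]. split; [apply ustar0|].
  exists 0. replace (0%R *: 1 - 0)%U with (u0 : U) by ucring. rewrite unorm0. lra. Qed.

Lemma upos_norm_sub h g : (h^*)%U = h -> unorm h <= g -> upos (g *: 1 - h)%U.
Proof.
  intros Hs Hg. split; [now autorewrite with ustar; rewrite Hs|]. exists g.
  now replace (g *: 1 - (g *: 1 - h))%U with h by ucring.
Qed.

Lemma upos_norm_add h g : (h^*)%U = h -> unorm h <= g -> upos (g *: 1 + h)%U.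
Proof.
  intros Hs Hg. replace h with (- - h)%U by ucring. apply upos_norm_sub.
  - now rewrite ustarN, Hs.
  - now rewrite unormN.
Qed.

Lemma upos_sqrt p : upos p ->
  exists k, upos k /\ (k * k)%U = p /\ forall c, ucomm c p -> ucomm c k.
Proof.
  intros [Hs [t Ht]].
  pose proof (unorm_ge0 U (t *: 1 - p)%U) as T0.
  (* [t] bounds a norm, so [t >= 0], and [t = 0] forces [p = 0]. Otherwise [1 - p / t] has norm at
     most 1, and [usqrt1] applied to it yields a root of [p / t]. *)
  destruct (Req_dec t 0) as [->|Nt].
  - exists u0. split; [apply upos0|split; [|intros; apply ucomm0]].
    rewrite umul0l. symmetry. apply unorm_eq0.
    replace (0%R *: 1 - p)%U with (- p)%U in Ht, T0 by ucring. rewrite unormN in *. lra.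
  - assert (P : 0 < t) by lra.
    destruct (usqrt1 (1 - / t *: p)%U) as [k [Pk [Ek Ck]]].
    + now autorewrite with ustar; rewrite Hs.
    + replace (1 - / t *: p)%U with (/ t *: (t *: 1 - p))%U by ucring.
      rewrite unormZ, Rabs_inv, Rabs_pos_eq by lra.
      apply Rmult_le_reg_l with t; [easy|]. rewrite <- Rmult_assoc, Rinv_r; lra.
    + exists (sqrt t *: k)%U. split; [|split].
      * apply upos_scal; [apply sqrt_pos|easy].
      * replace (sqrt t *: k * (sqrt t *: k))%U with ((sqrt t * sqrt t) *: (k * k))%U by ucring.
        rewrite sqrt_sqrt, Ek by lra. ucring.
      * intros c Hc. apply ucommZ, Ck. auto with ucomm.
Qed.

(* [h + i k] is [sqrt g] times a unitary. *)
Lemma unorm_circle h k g : (h^*)%U = h -> (k^*)%U = k -> ucomm h k -> 0 <= g ->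
  (h * h + k * k)%U = (g *: 1)%U -> unorm k * unorm k <= g.
Proof.
  intros Hh Hk C Hg E.
  assert (Nim : unorm (uim : U) <= 1).
  { pose proof (unorm_Cstar U uim) as H. rewrite uim_star in H.
    replace (- uim * uim : U)%U with (- (uim * uim) : U)%U in H by ucring.
    rewrite uim_sq, !unormN in H. pose proof (@unorm1 U). pose proof (unorm_ge0 U uim). nra. }
  set (u := (h + uim * k)%U).
  assert (Us : (u^*)%U = (h - uim * k)%U).
  { unfold u. autorewrite with ustar. rewrite Hh, Hk. ucomring. }
  assert (Nu : unorm u * unorm u <= g).
  { rewrite <- unorm_Cstar, Us. unfold u.
    replace ((h - uim * k) * (h + uim * k))%U with (h * h - (uim * uim) * (k * k))%U by ucomring.
    rewrite uim_sq. replace (h * h - - (1) * (k * k))%U with (h * h + k * k)%U by ucring.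
    rewrite E. now apply unorm_const. }
  assert (Ek : k = (/ 2 *: (uim * (u^* - u)))%U).
  { rewrite Us. unfold u.
    transitivity (- ((uim * uim) * k))%U; [rewrite uim_sq; ucring|ucring]. }
  assert (Nk : unorm k <= unorm u).
  { rewrite Ek, unormZ, Rabs_pos_eq by lra.
    pose proof (unormM U uim (u^* - u)%U). pose proof (unormB (u^*)%U u) as B.
    rewrite unorm_star in B. pose proof (unorm_ge0 U (u^* - u)%U).
    pose proof (unorm_ge0 U uim). nra. }
  pose proof (unorm_ge0 U k). nra.
Qed.

(** For [g > |h^2|] the element [g - h^2] is the square of a self-adjoint element commuting with
    [h]. By [unorm_circle] its norm is then at most [g], which is exactly what [upos] asks of
    [h^2]. *)
Lemma upos_sq h : (h^*)%U = h -> upos (h * h)%U.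
Proof.
  intro Hh. split; [now rewrite ustarM, Hh|].
  pose proof (unorm_ge0 U (h * h)%U). set (g := unorm (h * h)%U + 1). exists g.
  assert (Hg : 0 < g) by (unfold g; lra).
  destruct (usqrt1 (/ g *: (h * h))%U) as [k [[Sk _] [Ek Ck]]].
  - now autorewrite with ustar; rewrite Hh.
  - rewrite unormZ, Rabs_inv, Rabs_pos_eq by lra.
    apply Rmult_le_reg_l with g; [easy|]. rewrite <- Rmult_assoc, Rinv_r; unfold g in *; lra.
  - assert (E : (g *: 1 - h * h)%U = (sqrt g *: k * (sqrt g *: k))%U).
    { replace (sqrt g *: k * (sqrt g *: k))%U with ((sqrt g * sqrt g) *: (k * k))%U by ucring.
      rewrite sqrt_sqrt, Ek by lra. ucring. }
    rewrite E. eapply Rle_trans; [apply unormM|].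
    apply unorm_circle with h; auto with ucomm.
    + now rewrite ustarZ, Sk.
    + lra.
    + rewrite <- E. ucring.
Qed.

(** The roots of [p] and [g - p] commute and their squares add up to [g], so [unorm_circle] bounds
    the root of [p]. *)
Lemma upos_le_norm p g : upos p -> upos (g *: 1 - p)%U -> 0 <= g -> unorm p <= g.
Proof.
  intros Pp Pq Hg.
  destruct (upos_sqrt p Pp) as [h [[Sh _] [Eh Ch]]].
  destruct (upos_sqrt _ Pq) as [k [[Sk _] [Ek Ck]]].
  rewrite <- Eh. eapply Rle_trans; [apply unormM|].
  apply unorm_circle with k; auto.
  - apply ucommC, Ck. rewrite <- Eh. auto with ucomm.
  - rewrite Ek, Eh. ucring.
Qed.

Lemma upos_mono p c : upos p -> upos (c - p)%U -> unorm p <= unorm c.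
Proof.
  intros Pp Pc. apply upos_le_norm; [easy| |apply unorm_ge0].
  replace (unorm c *: 1 - p)%U with ((unorm c *: 1 - c) + (c - p))%U by ucring.
  apply upos_add; [|easy]. apply upos_norm_sub; [|lra].
  replace c with ((c - p) + p)%U by ucring. now apply upos_add.
Qed.

(** For positive [w] a scalar summand can be split off the norm; the triangle inequality alone would
    only give [g + s]. *)
Lemma upos_shift w g s : upos w -> 0 <= s -> s <= g -> unorm (w + s *: 1)%U <= g ->
  unorm w <= g - s.
Proof.
  intros Pw Hs Hg N. apply upos_le_norm; [easy| |lra].
  replace ((g - s)%R *: 1 - w)%U with (g *: 1 - (w + s *: 1))%U by ucring.
  apply upos_norm_sub; [|easy]. apply upos_add; [easy|]. now apply upos_const.
Qed.

Lemma upos_star_sum z : upos (z * z^* + z^* * z)%U.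
Proof.
  (* Up to sign, twice the real and imaginary parts of [z]. *)
  set (a := (z + z^*)%U). set (b := (uim * (z - z^*))%U).
  assert (Eb : (b * b)%U = (- ((z - z^*) * (z - z^*)))%U).
  { unfold b. set (c := (z - z^*)%U).
    transitivity ((uim * uim) * (c * c))%U; [ucomring|]. rewrite uim_sq. ucring. }
  replace (z * z^* + z^* * z)%U with (/ 2 *: (a * a) + / 2 *: (b * b))%U
    by (rewrite Eb; unfold a; ucring).
  apply upos_add; (apply upos_scal; [lra|]); apply upos_sq.
  - unfold a. autorewrite with ustar. ucring.
  - unfold b. autorewrite with ustar. rewrite umulDl, umulDr, !(uim_comm U _). ucring.
Qed.

(* With [H = z^* z], [w = z z^*] and [v] their common norm, [w + e] is
   positive since [w + H] is, while [w (v + w) = z (v + H) z^*] has norm at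
   most [v (v + e)]; these two facts are incompatible unless [v <= 7 e]. *)
Lemma ustar_mul_almost_neg z e : 0 <= e -> upos (e *: 1 - z^* * z)%U ->
  unorm (z^* * z)%U <= 7 * e.
Proof.
  intros He Pe. set (H := (z^* * z)%U) in *. set (w := (z * z^*)%U).
  assert (SH : (H^*)%U = H) by (unfold H; now autorewrite with ustar).
  assert (Sw : (w^*)%U = w) by (unfold w; now autorewrite with ustar).
  set (v := unorm H).
  assert (Nz : v = unorm z * unorm z) by (unfold v, H; apply unorm_Cstar).
  assert (Nw : unorm w = v).
  { unfold w. rewrite <- (ustarK U z) at 1. rewrite unorm_Cstar, unorm_star. easy. }
  pose proof (unorm_ge0 U H) as V0. fold v in V0.
  destruct (Rle_or_lt (v / 2) e) as [L|L]; [lra|].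
  assert (Pw : upos (w + e *: 1)%U).
  { replace (w + e *: 1)%U with ((w + H) + (e *: 1 - H))%U by ucring.
    apply upos_add; [apply upos_star_sum|easy]. }
  assert (N1 : unorm (v *: 1 + H)%U <= v + e).
  { apply upos_le_norm; [apply upos_norm_add; [easy|unfold v; lra]| |lra].
    now replace ((v + e)%R *: 1 - (v *: 1 + H))%U with (e *: 1 - H)%U by ucring. }
  assert (N2 : unorm (z * ((v *: 1 + H) * z^*))%U <= v * (v + e)).
  { eapply Rle_trans; [apply unormM|].
    pose proof (unormM U (v *: 1 + H)%U (z^*)%U) as M. rewrite unorm_star in M.
    pose proof (unorm_ge0 U z).
    apply Rle_trans with (unorm z * (unorm (v *: 1 + H)%U * unorm z)); [nra|].
    replace (unorm z * (unorm (v *: 1 + H)%U * unorm z))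
      with (v * unorm (v *: 1 + H)%U) by (rewrite Nz at 1; ring). nra. }
  (* Completing the square: [(w + v/2)^2 = w (v + w) + v^2/4], whose norm is at most
     [v (v + e) + v^2/4 = g^2]. *)
  set (g := sqrt (5 / 4 * (v * v) + v * e)).
  assert (Eg : g * g = 5 / 4 * (v * v) + v * e) by (apply sqrt_sqrt; nra).
  assert (G0 : 0 <= g) by apply sqrt_pos.
  assert (N3 : unorm (w + (v / 2) *: 1)%U <= g).
  { pose proof (unorm_selfadj_sq (w + (v / 2) *: 1)%U) as Q.
    rewrite ustarD, ustarZ, ustar1, Sw in Q. specialize (Q eq_refl).
    replace ((w + (v / 2) *: 1) * (w + (v / 2) *: 1))%U
      with (z * ((v *: 1 + H) * z^*) + (v / 2 * (v / 2)) *: 1)%U in Q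
      by (unfold w, H; ucring).
    pose proof (unormD U (z * ((v *: 1 + H) * z^*))%U ((v / 2 * (v / 2)) *: 1)%U).
    pose proof (@unorm_const U (v / 2 * (v / 2)) ltac:(nra)).
    pose proof (unorm_ge0 U (w + (v / 2) *: 1)%U). nra. }
  assert (N4 : unorm (w + e *: 1)%U <= g - (v / 2 - e)).
  { apply upos_shift; [easy|lra|nra|].
    now replace (w + e *: 1 + (v / 2 - e)%R *: 1)%U with (w + (v / 2) *: 1)%U by ucring. }
  assert (N5 : v <= unorm (w + e *: 1)%U + e).
  { rewrite <- Nw at 1. replace w with ((w + e *: 1) - e *: 1)%U at 1 by ucring.
    eapply Rle_trans; [apply unormB|]. pose proof (@unorm_const U e He). lra. }
  (* The bounds combine to [3v/2 - 2e <= g]. The left side is nonnegative, and squaring gives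
     [v^2 + 4 e^2 <= 7 v e]; this is where the constant 7 comes from. *)
  nra.
Qed.

(** Takes the place of the spectral radius formula: a bound on the growth of powers becomes a bound
    on the norm. *)
Lemma unorm_selfadj_pow2 h (k : nat) : (h^*)%U = h -> unorm (upow h (2 ^ k)) = unorm h ^ (2 ^ k).
Proof.
  intro Hh. induction k as [|k IH]; simpl.
  - now rewrite umul1r, Rmult_1_r.
  - rewrite Nat.add_0_r, upow_add, unorm_selfadj_sq, IH, <- pow_add; [easy|].
    now apply upow_star.
Qed.

(* With [d = 1 - x^* x = m^2] and [z = x d^n], the element
   [1 - z^* z = m^2 + sum_(i < n) ((h d^i)^2 + (h d^i m)^2)] is positive, so the
   powers of [d] grow at most linearly, which forces [unorm d <= 1]. *)
Lemma upos_star_mul x : upos (x^* * x)%U.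
Proof.
  assert (main : forall y, unorm (y^* * y)%U <= 1 -> upos (y^* * y)%U).
  { clear x. intros x. set (h := (x^* * x)%U).
    assert (Sh : (h^*)%U = h) by (unfold h; now autorewrite with ustar).
    intro Nh. split; [easy|]. exists 1.
    destruct (usqrt1 h Sh Nh) as [m [[Sm _] [Em Cm]]].
    set (d := (1 - h)%U). fold d in Em.
    assert (Sd : (d^*)%U = d) by (unfold d; now autorewrite with ustar; rewrite Sh).
    assert (Chm : ucomm h m) by (apply Cm, ucomm_refl).
    assert (Chd : ucomm h d) by (unfold d; auto with ucomm).
    assert (Cmd : ucomm m d) by (unfold d; auto with ucomm).
    assert (Eh : h = (1 - d)%U) by (unfold d; ucring).
    assert (SDn : forall n, ((upow d n)^*)%U = upow d n) by (intro; now apply upow_star).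
    assert (P : forall n, upos (1 - h * (upow d n * upow d n))%U).
    { intro n. induction n as [|n IH].
      - simpl. replace (1 - h * (1 * 1))%U with (m * m)%U by (rewrite Em; unfold d; ucring).
        now apply upos_sq.
      - simpl. pose proof (SDn n) as SD. set (D := upow d n) in *.
        assert (CD : ucomm h D) by (unfold D; auto with ucomm).
        assert (CmD : ucomm m D) by (unfold D; auto with ucomm).
        assert (CdD : ucomm d D) by (unfold D; auto with ucomm).
        replace (1 - h * (d * D * (d * D)))%U
          with ((1 - h * (D * D)) + ((h * D) * (h * D) + (h * D * m) * (h * D * m)))%U.
        + apply upos_add; [easy|]. apply upos_add; apply upos_sq.
          * rewrite ustarM, Sh, SD. symmetry. exact CD.
          * rewrite !ustarM, Sh, Sm, SD. ucomring.
        + transitivity ((1 - h * (D * D)) + ((h * D) * (h * D) + (h * D) * (h * D) * (m * m)))%U;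
            [ucomring|].
          rewrite Em, Eh. ucomring. }
    assert (B : forall n, unorm (h * (upow d n * upow d n))%U <= 7).
    { intro n. assert (CD : ucomm h (upow d n)) by auto with ucomm.
      assert (Ez : (h * (upow d n * upow d n))%U = ((x * upow d n)^* * (x * upow d n))%U).
      { rewrite ustarM, SDn. transitivity (upow d n * h * upow d n)%U; [ucomring|].
        unfold h. ucring. }
      rewrite Ez. pose proof (ustar_mul_almost_neg (x * upow d n)%U 1) as K.
      rewrite <- Ez, uscal1 in K. specialize (K ltac:(lra) (P n)). rewrite <- Ez. lra. }
    assert (Nd : unorm d <= 2).
    { unfold d. eapply Rle_trans; [apply unormB|]. pose proof (@unorm1 U). lra. }
    (* Since [d^2 = 1 - h (1 + d)], each step subtracts [h d^(2n) (1 + d)], of norm at most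
       [7 * 3 = 21]. *)
    assert (G : forall n, unorm (upow d n * upow d n)%U <= 1 + 21 * INR n).
    { intro n. induction n as [|n IH].
      - simpl. rewrite umul1l. pose proof (@unorm1 U). lra.
      - rewrite S_INR. simpl upow. set (D := upow d n) in *.
        assert (CD : ucomm h D) by (unfold D; auto with ucomm).
        assert (CdD : ucomm d D) by (unfold D; auto with ucomm).
        replace (d * D * (d * D))%U with (D * D - (h * (D * D)) * (1 + d))%U
          by (rewrite Eh; ucomring).
        eapply Rle_trans; [apply unormB|].
        pose proof (unormM U (h * (D * D))%U (1 + d)%U). pose proof (unormD U 1%U d).
        pose proof (@unorm1 U). pose proof (B n) as Bn. fold D in Bn.
        pose proof (unorm_ge0 U (h * (D * D))%U). pose proof (unorm_ge0 U (1 + d)%U).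
        nra. }
    assert (L : unorm d <= 1).
    { apply Rnot_lt_le. intro Y. set (y := unorm d) in *.
      assert (Gy : forall k : nat, y ^ (2 ^ k) * y ^ (2 ^ k) <= 1 + 21 * INR (2 ^ k)).
      { intro k. unfold y. rewrite <- (unorm_selfadj_pow2 d k Sd), <- unorm_selfadj_sq; [apply G|].
        apply SDn. }
      assert (By : forall n, 1 + INR n * (y - 1) <= y ^ n).
      { intro n. replace y with (1 + (y - 1)) at 2 by ring. apply poly. lra. }
      (* With [N = 2^k], Bernoulli gives [y^(2N) >= (1 + N (y - 1))^2 > N^2 (y - 1)^2]. Once
         [N (y - 1)^2 > 22] this exceeds [22 N >= 1 + 21 N]. *)
      destruct (INR_unbounded (22 / ((y - 1) * (y - 1)))) as [k Hk].
      specialize (Gy k). specialize (By (2 ^ k)%nat).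
      assert (K : INR k < INR (2 ^ k)) by (apply lt_INR, Nat.pow_gt_lin_r; lia).
      set (N := INR (2 ^ k)) in *. set (Y1 := y - 1) in *.
      assert (0 < Y1) by (unfold Y1; lra).
      assert (T : 22 < N * (Y1 * Y1)).
      { apply Rmult_lt_reg_r with (/ (Y1 * Y1)); [apply Rinv_0_lt_compat; nra|].
        replace (N * (Y1 * Y1) * / (Y1 * Y1)) with N by (field; lra).
        unfold Rdiv in Hk. lra. }
      assert (1 <= N).
      { pose proof (pos_INR k). change 1 with (INR 1). apply le_INR.
        pose proof (Nat.pow_nonzero 2 k). lia. }
      assert (S2 : (1 + N * Y1) * (1 + N * Y1) <= 1 + 21 * N).
      { assert (0 <= N * Y1) by nra. nra. }
      nra. }
    now rewrite uscal1. }
  set (a := unorm x * unorm x + 1).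
  pose proof (unorm_ge0 U x).
  assert (A : 0 < a) by (unfold a; nra).
  replace (x^* * x)%U with (a *: ((sqrt (/ a) *: x)^* * (sqrt (/ a) *: x)))%U.
  - apply upos_scal; [lra|]. apply main. rewrite unorm_Cstar, unormZ.
    rewrite Rabs_pos_eq by apply sqrt_pos.
    replace (sqrt (/ a) * unorm x * (sqrt (/ a) * unorm x))
      with (sqrt (/ a) * sqrt (/ a) * (unorm x * unorm x)) by ring.
    rewrite sqrt_sqrt by (apply Rlt_le, Rinv_0_lt_compat, A).
    apply Rmult_le_reg_l with a; [easy|].
    rewrite <- Rmult_assoc, Rinv_r by lra. unfold a. lra.
  - rewrite ustarZ.
    replace (a *: (sqrt (/ a) *: x^* * (sqrt (/ a) *: x)))%U
      with ((a * (sqrt (/ a) * sqrt (/ a))) *: (x^* * x))%U by ucring.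
    rewrite sqrt_sqrt by (apply Rlt_le, Rinv_0_lt_compat, A).
    rewrite Rinv_r by lra. apply uscal1.
Qed.

Lemma upos_conj p b : upos p -> upos (b^* * p * b)%U.
Proof.
  intro Pp. destruct (upos_sqrt p Pp) as [k [[Sk _] [Ek _]]].
  replace (b^* * p * b)%U with ((k * b)^* * (k * b))%U; [apply upos_star_mul|].
  rewrite ustarM, Sk, <- Ek. ucring.
Qed.

(** Operator form of [n t (1 - t)^n <= 1] on [[0, 1]]. It gives the rate of convergence of the
    approximate units below. *)
Lemma unorm_decay K n : upos K -> unorm K <= 1 ->
  INR n * unorm (K * upow (1 - K) n)%U <= 1.
Proof.
  intros PK NK. pose proof PK as [SK _].
  destruct (usqrt1 K SK NK) as [m [[Sm _] [Em Cm]]].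
  assert (CKm : ucomm K m) by (apply Cm, ucomm_refl).
  set (q := (1 - K)%U) in *.
  assert (EK : K = (1 - q)%U) by (unfold q; ucring).
  assert (CKq : ucomm K q) by (unfold q; auto with ucomm).
  assert (Cmq : ucomm m q) by (unfold q; auto with ucomm).
  assert (Smn : forall n, ((upow m n)^*)%U = upow m n) by (intro; now apply upow_star).
  assert (Eq : forall n, upow q n = (upow m n * upow m n)%U).
  { clear n. intro n. induction n as [|n IH]; simpl; [now rewrite umul1l|].
    rewrite IH, <- Em. assert (ucomm m (upow m n)) by auto with ucomm. ucomring. }
  assert (P1 : forall n, upos (K * upow q n)%U).
  { clear n. intro n. replace (K * upow q n)%U with ((upow m n)^* * K * upow m n)%U;
      [now apply upos_conj|].
    rewrite Smn, Eq. assert (ucomm K (upow m n)) by auto with ucomm. ucomring. }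
  assert (P2 : forall n, upos (K * (1 - upow q n))%U).
  { clear n. intro n. induction n as [|n IH]; simpl.
    - replace (K * (1 - 1))%U with (u0 : U) by ucring. apply upos0.
    - set (M := upow m n). assert (CM : ucomm K M) by (unfold M; auto with ucomm).
      assert (CqM : ucomm q M) by (unfold M; auto with ucomm).
      replace (K * (1 - q * upow q n))%U
        with (K * (1 - upow q n) + (K * M) * (K * M))%U.
      + apply upos_add; [easy|]. apply upos_sq. unfold M. rewrite ustarM, SK, Smn.
        symmetry. exact CM.
      + rewrite !Eq. fold M. rewrite EK. ucomring. }
  (* Because [q + K = 1], the expression for [n + 1] equals [q (1 - n K q^n) + K (1 - q^(n+1))].
     Multiplication by [q] is conjugation by its root [m], and the second term is [P2]. *)
  assert (P3 : forall n, upos (1 - INR n *: (K * upow q n))%U).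
  { clear n. intro n. induction n as [|n IH].
    - simpl. replace (1 - 0%R *: (K * 1))%U with (u1 : U) by ucring. apply upos1.
    - rewrite S_INR. simpl upow. set (Q := upow q n) in *.
      assert (CQ : ucomm K Q) by (unfold Q; auto with ucomm).
      assert (CqQ : ucomm q Q) by (unfold Q; auto with ucomm).
      assert (CmQ : ucomm m Q) by (unfold Q; auto with ucomm).
      replace (1 - (INR n + 1)%R *: (K * (q * Q)))%U
        with (m^* * (1 - INR n *: (K * Q)) * m + K * (1 - q * Q))%U.
      + apply upos_add; [now apply upos_conj|]. apply (P2 (S n)).
      + rewrite Sm.
        transitivity ((m * m) * (1 - INR n *: (K * Q)) + K * (1 - q * Q))%U; [ucomring|].
        rewrite Em, EK. ucomring. }
  pose proof (pos_INR n).
  rewrite <- (Rabs_pos_eq (INR n)), <- unormZ by easy.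
  apply upos_le_norm; [|now rewrite uscal1|lra]. apply upos_scal; [easy|apply P1].
Qed.

(** Bernoulli's inequality for positive elements. Products with [K] stay positive because everything
    in sight commutes with the root [r] of [K]. *)
Lemma upos_pow_succ K n : upos K -> upos (upow (1 + K) n - 1 - INR n *: K)%U.
Proof.
  intro PK. destruct (upos_sqrt K PK) as [r [[Sr _] [Er _]]].
  assert (CK : ucomm K r) by (red; rewrite <- Er; ucring).
  assert (CP : forall n, ucomm r (upow (1 + K)%U n)) by (intro; auto with ucomm).
  assert (C : forall p, ucomm r p -> upos p -> upos (K * p)%U).
  { intros p Cp Pp. replace (K * p)%U with (r^* * p * r)%U; [now apply upos_conj|].
    rewrite Sr, <- Er. ucomring. }
  assert (P1 : forall n, upos (upow (1 + K)%U n)).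
  { clear n. intro n. induction n as [|n IH]; simpl; [apply upos1|].
    rewrite umulDl, umul1l. apply upos_add; auto. }
  assert (P2 : forall n, upos (upow (1 + K) n - 1)%U).
  { clear n. intro n. induction n as [|n IH]; simpl; [rewrite uaddN; apply upos0|].
    replace ((1 + K) * upow (1 + K) n - 1)%U
      with ((upow (1 + K) n - 1) + K * upow (1 + K) n)%U by ucring.
    apply upos_add; auto. }
  induction n as [|n IH].
  - simpl. replace (1 - 1 - 0%R *: K)%U with (u0 : U) by ucring. apply upos0.
  - rewrite S_INR. simpl upow.
    replace ((1 + K) * upow (1 + K) n - 1 - (INR n + 1)%R *: K)%U
      with ((upow (1 + K) n - 1 - INR n *: K) + K * (upow (1 + K) n - 1))%U by ucring.
    apply upos_add; auto with ucomm.
Qed.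

End Positive.

(** * The multiplier algebra *)

Section RealScalars.
Context {V : ModuleSpace C_Ring}.

Lemma scal_RtoC_mult (a b : R) (x : V) :
  scal (RtoC a) (scal (RtoC b) x) = scal (RtoC (a * b)) x.
Proof. rewrite RtoC_mult. apply (scal_assoc (RtoC a) (RtoC b) x). Qed.

Lemma scal_RtoC_1 (x : V) : scal (RtoC 1) x = x.
Proof. exact (scal_one x). Qed.

Lemma scal_RtoC_plus (a b : R) (x : V) :
  scal (RtoC (a + b)) x = plus (scal (RtoC a) x) (scal (RtoC b) x).
Proof. rewrite RtoC_plus. apply (scal_distr_r (RtoC a) (RtoC b) x). Qed.

Lemma scal_RtoC_0 (x : V) : scal (RtoC 0) x = zero.
Proof. exact (scal_zero_l x). Qed.

Lemma scal_RtoC_N1 (x : V) : scal (RtoC (-1)) x = opp x.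
Proof.
  rewrite <- (scal_opp_one x). f_equal.
  change (RtoC (-1) = Copp (RtoC 1)). rewrite <- RtoC_opp. f_equal; ring.
Qed.

Lemma minus_eq0 (x y : V) : minus x y = zero -> x = y.
Proof.
  intro H. apply plus_reg_r with (opp y). rewrite plus_opp_r. exact H.
Qed.

End RealScalars.

(* Coquelicot's operations on the carrier of a [CstarAlgebra], with types
   pinned to that carrier: their implicit structure arguments otherwise depend
   on how a term was elaborated, which blocks rewriting. *)
Section CstarBasics.
Context {A : CstarAlgebra}.
Implicit Types a b x y z : A.

Definition azero : A := zero.
Definition aplus x y : A := plus x y.
Definition aopp x : A := opp x.
Definition aminus x y : A := minus x y.
Definition ascal (k : C) x : A := scal k x.
Definition anorm x : R := norm x.

Lemma aplusC x y : aplus x y = aplus y x.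
Proof. exact (plus_comm x y). Qed.
Lemma aplusA x y z : aplus x (aplus y z) = aplus (aplus x y) z.
Proof. exact (plus_assoc x y z). Qed.
Lemma aplus0 x : aplus x azero = x.
Proof. exact (plus_zero_r x). Qed.
Lemma aplus0l x : aplus azero x = x.
Proof. exact (plus_zero_l x). Qed.
Lemma aplusN x : aplus x (aopp x) = azero.
Proof. exact (plus_opp_r x). Qed.
Lemma aoppB x y : aopp (aminus x y) = aminus y x.
Proof. exact (opp_minus x y). Qed.
Lemma aminus_diag x : aminus x x = azero.
Proof. exact (minus_eq_zero x). Qed.
Lemma aminus_eq0 x y : aminus x y = azero -> x = y.
Proof. exact (minus_eq0 (V := A) x y). Qed.
Lemma aminus_trans x y z : aminus x y = aplus (aminus x z) (aminus z y).
Proof. exact (minus_trans (G := A) z x y). Qed.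
Lemma anorm0 : anorm azero = 0.
Proof. exact (norm_zero (V := A)). Qed.
Lemma anorm_eq0 x : anorm x = 0 -> x = azero.
Proof. exact (norm_eq_zero x). Qed.
Lemma anormN x : anorm (aopp x) = anorm x.
Proof. exact (norm_opp x). Qed.
Lemma anormD x y : anorm (aplus x y) <= anorm x + anorm y.
Proof. exact (norm_triangle x y). Qed.
Lemma anormZ_le (k : C) x : anorm (ascal k x) <= Cmod k * anorm x.
Proof. exact (norm_scal (k : C_AbsRing) x). Qed.
Lemma anorm_ge0 x : 0 <= anorm x.
Proof. exact (norm_ge_0 x). Qed.
Lemma ascalA (k l : C) x : ascal k (ascal l x) = ascal (Cmult k l) x.
Proof. exact (scal_assoc (V := A) k l x). Qed.
Lemma ascalDr (k : C) x y : ascal k (aplus x y) = aplus (ascal k x) (ascal k y).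
Proof. exact (scal_distr_l (V := A) k x y). Qed.
Lemma ascal_mult (r s : R) x : ascal (RtoC r) (ascal (RtoC s) x) = ascal (RtoC (r * s)) x.
Proof. exact (scal_RtoC_mult (V := A) r s x). Qed.
Lemma ascal1 x : ascal (RtoC 1) x = x.
Proof. exact (scal_RtoC_1 (V := A) x). Qed.
Lemma ascal_plus (r s : R) x :
  ascal (RtoC (r + s)) x = aplus (ascal (RtoC r) x) (ascal (RtoC s) x).
Proof. exact (scal_RtoC_plus (V := A) r s x). Qed.
Lemma ascal0 x : ascal (RtoC 0) x = azero.
Proof. exact (scal_RtoC_0 (V := A) x). Qed.
Lemma ascalN1 x : ascal (RtoC (-1)) x = aopp x.
Proof. exact (scal_RtoC_N1 (V := A) x). Qed.
Lemma acmulDl x y z : cmul A (aplus x y) z = aplus (cmul A x z) (cmul A y z).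
Proof. exact (cmul_plus_l A x y z). Qed.
Lemma acmulDr x y z : cmul A x (aplus y z) = aplus (cmul A x y) (cmul A x z).
Proof. exact (cmul_plus_r A x y z). Qed.
Lemma acmulZl (k : C) x y : cmul A (ascal k x) y = ascal k (cmul A x y).
Proof. exact (cmul_scal_l A k x y). Qed.
Lemma acmulZr (k : C) x y : cmul A x (ascal k y) = ascal k (cmul A x y).
Proof. exact (cmul_scal_r A k x y). Qed.
Lemma acstarD x y : cstar A (aplus x y) = aplus (cstar A x) (cstar A y).
Proof. exact (cstar_plus A x y). Qed.
Lemma acstarZ (k : C) x : cstar A (ascal k x) = ascal (Cconj k) (cstar A x).
Proof. exact (cstar_scal A k x). Qed.
Lemma anorm_cmul x y : anorm (cmul A x y) <= anorm x * anorm y.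
Proof. exact (norm_cmul A x y). Qed.
Lemma anorm_cstar_id x : anorm (cmul A (cstar A x) x) = anorm x * anorm x.
Proof. exact (norm_cstar_id A x). Qed.

Lemma acmul0l x : cmul A azero x = azero.
Proof. rewrite <- (ascal0 azero), acmulZl. now rewrite !ascal0. Qed.

Lemma acmul0r x : cmul A x azero = azero.
Proof. rewrite <- (ascal0 azero), acmulZr. now rewrite !ascal0. Qed.

Lemma acmulBl x y z : cmul A (aminus x y) z = aminus (cmul A x z) (cmul A y z).
Proof.
  change (cmul A (aplus x (aopp y)) z = aplus (cmul A x z) (aopp (cmul A y z))).
  now rewrite acmulDl, <- !ascalN1, acmulZl.
Qed.

Lemma acmulBr x y z : cmul A x (aminus y z) = aminus (cmul A x y) (cmul A x z).
Proof.
  change (cmul A x (aplus y (aopp z)) = aplus (cmul A x y) (aopp (cmul A x z))).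
  now rewrite acmulDr, <- !ascalN1, acmulZr.
Qed.

Lemma Cconj_RtoC r : Cconj (RtoC r) = RtoC r.
Proof. unfold Cconj, RtoC; simpl. now rewrite Ropp_0. Qed.

Lemma acstarB x y : cstar A (aminus x y) = aminus (cstar A x) (cstar A y).
Proof.
  change (cstar A (aplus x (aopp y)) = aplus (cstar A x) (aopp (cstar A y))).
  now rewrite acstarD, <- !ascalN1, acstarZ, Cconj_RtoC.
Qed.

Lemma acstar0 : cstar A azero = azero.
Proof. rewrite <- (ascal0 azero), acstarZ, Cconj_RtoC. now rewrite !ascal0. Qed.

Lemma anorm_scal r x : anorm (ascal (RtoC r) x) = Rabs r * anorm x.
Proof.
  assert (le : forall r x, anorm (ascal (RtoC r) x) <= Rabs r * anorm x).
  { intros s v. rewrite <- Cmod_R. apply anormZ_le. }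
  apply Rle_antisym; [apply le|].
  destruct (Req_dec r 0) as [->|Hr].
  - rewrite Rabs_R0, Rmult_0_l. apply anorm_ge0.
  - pose proof (le (/ r) (ascal (RtoC r) x)) as L.
    rewrite ascal_mult, Rinv_l, ascal1, Rabs_inv in L by easy.
    apply Rmult_le_reg_l with (/ Rabs r); [now apply Rinv_0_lt_compat, Rabs_pos_lt|].
    rewrite <- Rmult_assoc, Rinv_l, Rmult_1_l; [exact L|now apply Rabs_no_R0].
Qed.

Lemma anorm_cstar x : anorm (cstar A x) = anorm x.
Proof.
  assert (le : forall y : A, anorm y <= anorm (cstar A y)).
  { intro y. destruct (anorm_ge0 y) as [P|P].
    - apply Rmult_le_reg_r with (anorm y); [easy|].
      rewrite <- anorm_cstar_id. apply anorm_cmul.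
    - rewrite <- P. apply anorm_ge0. }
  apply Rle_antisym; [|apply le]. rewrite <- (cstar_invol A x) at 2. apply le.
Qed.

Lemma anorm_minus_sym x y : anorm (aminus x y) = anorm (aminus y x).
Proof. rewrite <- anormN, aoppB. reflexivity. Qed.

Lemma cstar_mul_eq0 x : cmul A (cstar A x) x = azero -> x = azero.
Proof.
  intro H. apply anorm_eq0. pose proof (anorm_cstar_id x) as N.
  rewrite H, anorm0 in N. nra.
Qed.

(** Testing with [z = x - y] replaces evaluation at a unit. All algebraic properties of multipliers
    are derived through it. *)
Lemma cmul_cstar_inj x y :
  (forall z, cmul A (cstar A x) z = cmul A (cstar A y) z) -> x = y.
Proof.
  intro H. apply aminus_eq0, cstar_mul_eq0.
  rewrite acstarB, acmulBl, (H (aminus x y)). apply aminus_diag.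
Qed.

End CstarBasics.

(** The adjointable operators of [A], seen as a Hilbert module over itself with inner product
    [x^* y]. Linearity and compatibility with right multiplication follow from [madjP]. *)
Record multiplier (A : CstarAlgebra) := {
  mfun :> A -> A;
  madj : A -> A;
  madjP : forall x y, cmul A (cstar A (mfun x)) y = cmul A (cstar A x) (madj y);
  mbounded : exists c, forall y, anorm (mfun y) <= c * anorm y
}.
Arguments mfun {A} _ _. Arguments madj {A} _ _.

Section Multiplier.
Context {A : CstarAlgebra}.
Implicit Types S T : multiplier A.
Implicit Types x y z : A.

Lemma madjP' S x y : cmul A (cstar A (madj S x)) y = cmul A (cstar A x) (S y).
Proof.
  rewrite <- (cstar_invol A (cmul A (cstar A (madj S x)) y)), cstar_cmul, cstar_invol.
  now rewrite <- madjP, cstar_cmul, cstar_invol.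
Qed.

Lemma multiplier_eq S T : (forall x, S x = T x) -> S = T.
Proof.
  intro H.
  assert (Ha : forall x, madj S x = madj T x).
  { intro x. apply cmul_cstar_inj. intro z. now rewrite !madjP', H. }
  destruct S as [f g p b], T as [f' g' p' b']. simpl in *.
  assert (f = f') by now apply functional_extensionality.
  assert (g = g') by now apply functional_extensionality.
  subst. f_equal; apply proof_irrelevance.
Qed.

Lemma mfun_plus S x y : S (aplus x y) = aplus (S x) (S y).
Proof.
  apply cmul_cstar_inj. intro z.
  now rewrite madjP, !acstarD, !acmulDl, !madjP.
Qed.

Lemma mfun_scal S (k : C) x : S (ascal k x) = ascal k (S x).
Proof.
  apply cmul_cstar_inj. intro z.
  now rewrite madjP, !acstarZ, !acmulZl, !madjP.
Qed.

Lemma mfun0 S : S azero = azero.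
Proof. rewrite <- (ascal0 azero) at 1. rewrite mfun_scal. apply ascal0. Qed.

Lemma mfun_cmul S x y : S (cmul A x y) = cmul A (S x) y.
Proof.
  apply cmul_cstar_inj. intro z.
  now rewrite madjP, !cstar_cmul, !cmul_assoc, !madjP.
Qed.

Lemma madj_bound S c y : (forall y, anorm (S y) <= c * anorm y) -> anorm (madj S y) <= c * anorm y.
Proof.
  intro H. destruct (anorm_ge0 (madj S y)) as [P|P].
  - apply Rmult_le_reg_r with (anorm (madj S y)); [easy|].
    rewrite <- anorm_cstar_id, madjP'.
    eapply Rle_trans; [apply anorm_cmul|]. rewrite anorm_cstar.
    pose proof (H (madj S y)). pose proof (anorm_ge0 y). nra.
  - rewrite <- P. pose proof (H y). pose proof (anorm_ge0 (S y)). lra.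
Qed.

Definition mnorm S : R :=
  real (Lub_Rbar (fun r => exists y : A, anorm y <= 1 /\ r = anorm (S y))).

Lemma mnorm_lub S :
  (forall y, anorm (S y) <= mnorm S * anorm y) /\ 0 <= mnorm S /\
  (forall c, 0 <= c -> (forall y, anorm (S y) <= c * anorm y) -> mnorm S <= c).
Proof.
  destruct (mbounded A S) as [c0 H0].
  unfold mnorm. set (E := fun r => exists y : A, anorm y <= 1 /\ r = anorm (S y)).
  (* The supremum is finite: the value at zero excludes [m_infty], and [mbounded] excludes
     [p_infty]. *)
  destruct (Lub_Rbar_correct E) as [ub least].
  assert (E0 : E 0).
  { exists azero. rewrite anorm0. split; [lra|].
    now rewrite mfun0, anorm0. }
  assert (B : forall c, 0 <= c -> (forall y, anorm (S y) <= c * anorm y) ->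
     Rbar_le (Lub_Rbar E) (Finite c)).
  { intros c Hc H. apply least. intros r [y [Hy ->]]. simpl.
    pose proof (H y). nra. }
  assert (F : exists l, Lub_Rbar E = Finite l).
  { pose proof (B (Rabs c0) (Rabs_pos c0)) as B0.
    pose proof (ub _ E0) as U0.
    destruct (Lub_Rbar E) as [l| |]; [now exists l| |]; simpl in *; [|contradiction].
    exfalso. apply B0. intro y. eapply Rle_trans; [apply H0|].
    apply Rmult_le_compat_r; [apply anorm_ge0|apply Rle_abs]. }
  destruct F as [l Hl]. rewrite Hl in *. simpl.
  split; [|split].
  - intro y. destruct (anorm_ge0 y) as [P|P].
    + assert (Q : E (anorm (S (ascal (RtoC (/ anorm y)) y)))).
      { eexists. split; [|reflexivity]. rewrite anorm_scal, Rabs_inv, Rabs_pos_eq by lra.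
        rewrite Rinv_l; lra. }
      apply ub in Q. simpl in Q. rewrite mfun_scal, anorm_scal, Rabs_inv, Rabs_pos_eq in Q by lra.
      apply Rmult_le_reg_l with (/ anorm y); [now apply Rinv_0_lt_compat|].
      replace (/ anorm y * (l * anorm y)) with l by (field; lra). exact Q.
    + symmetry in P. apply anorm_eq0 in P. subst y.
      rewrite mfun0, anorm0. lra.
  - exact (ub _ E0).
  - intros c Hc H. exact (B c Hc H).
Qed.

Lemma mnormP S y : anorm (S y) <= mnorm S * anorm y.
Proof. apply mnorm_lub. Qed.
Lemma mnorm_ge0 S : 0 <= mnorm S.
Proof. apply mnorm_lub. Qed.
Lemma mnorm_le S c : 0 <= c -> (forall y, anorm (S y) <= c * anorm y) -> mnorm S <= c.
Proof. apply mnorm_lub. Qed.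

Definition mzero : multiplier A.
Proof.
  exists (fun _ => azero) (fun _ => azero).
  - intros. now rewrite acstar0, acmul0l, acmul0r.
  - exists 0. intro. rewrite anorm0. lra.
Defined.

Definition mone : multiplier A.
Proof. exists (fun x => x) (fun x => x); [easy|]. exists 1. intro. lra. Defined.

Definition mplus S T : multiplier A.
Proof.
  exists (fun x => aplus (S x) (T x)) (fun x => aplus (madj S x) (madj T x)).
  - intros. now rewrite acstarD, acmulDl, acmulDr, !madjP.
  - exists (mnorm S + mnorm T). intro y. eapply Rle_trans; [apply anormD|].
    pose proof (mnormP S y). pose proof (mnormP T y). lra.
Defined.

Definition mscal (k : C) S : multiplier A.
Proof.
  exists (fun x => ascal k (S x)) (fun x => ascal (Cconj k) (madj S x)).
  - intros. now rewrite acstarZ, acmulZl, acmulZr, madjP.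
  - exists (Cmod k * mnorm S). intro y.
    eapply Rle_trans; [apply anormZ_le|].
    rewrite Rmult_assoc. apply Rmult_le_compat_l; [apply Cmod_ge_0|apply mnormP].
Defined.

Definition mcomp S T : multiplier A.
Proof.
  exists (fun x => S (T x)) (fun x => madj T (madj S x)).
  - intros. now rewrite !madjP.
  - exists (mnorm S * mnorm T). intro y. eapply Rle_trans; [apply mnormP|].
    rewrite Rmult_assoc. apply Rmult_le_compat_l; [apply mnorm_ge0|apply mnormP].
Defined.

Definition mstar S : multiplier A.
Proof.
  exists (madj S) (mfun S).
  - apply madjP'.
  - exists (mnorm S). intro y. apply madj_bound. apply mnormP.
Defined.

Definition mopp S := mscal (RtoC (-1)) S.

Lemma mopp_fun S x : mopp S x = aopp (S x).
Proof. apply (ascalN1 (S x)). Qed.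

Lemma anorm_complete (u : nat -> A) :
  (forall eps, 0 < eps -> exists N, forall p q, (N <= p)%nat -> (N <= q)%nat ->
     anorm (aminus (u p) (u q)) < eps) ->
  exists l, forall eps, 0 < eps -> exists N, forall p, (N <= p)%nat ->
     anorm (aminus (u p) l) < eps.
Proof.
  intro H.
  destruct (proj1 (filterlim_locally_cauchy (F := eventually) u)) as [l Hl].
  - intro eps. destruct (H eps (cond_pos eps)) as [N HN].
    exists (fun n => (N <= n)%nat). split; [now exists N|].
    intros p q Hp Hq. apply (norm_compat1 (V := A)). now apply HN.
  - exists l. intros eps He.
    pose proof (@norm_factor_gt_0 _ A) as Hf.
    set (f := @norm_factor _ A) in *.
    assert (P : 0 < eps / f) by now apply Rdiv_lt_0_compat.
    destruct (proj1 (filterlim_locally u l) Hl (mkposreal _ P)) as [N HN].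
    exists N. intros p Hp. specialize (HN p Hp). apply (norm_compat2 (V := A)) in HN.
    simpl in HN. fold f in HN. replace (f * (eps / f)) with eps in HN by (field; lra).
    exact HN.
Qed.

Lemma anorm_small x : (forall eps, 0 < eps -> anorm x <= eps) -> x = azero.
Proof.
  intro H. apply anorm_eq0, Rle_antisym; [|apply anorm_ge0].
  apply le_epsilon. intros e He. rewrite Rplus_0_l. now apply H.
Qed.

(** The maps and their adjoints converge pointwise, and the Cauchy condition makes the convergence
    of the maps uniform on bounded sets. The adjoint relation passes to the pointwise limits. *)
Lemma multiplier_complete (u : nat -> multiplier A) :
  (forall eps, 0 < eps -> exists N, forall p q, (N <= p)%nat -> (N <= q)%nat ->
     mnorm (mplus (u p) (mopp (u q))) < eps) ->
  exists l, forall eps, 0 < eps -> exists N, forall p, (N <= p)%nat ->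
     mnorm (mplus (u p) (mopp l)) < eps.
Proof.
  intro H.
  assert (D : forall p q y, anorm (aminus (u p y) (u q y)) <= mnorm (mplus (u p) (mopp (u q))) * anorm y).
  { intros p q y. pose proof (mnormP (mplus (u p) (mopp (u q))) y) as K.
    change (mplus (u p) (mopp (u q)) y) with (aplus (u p y) (mopp (u q) y)) in K.
    now rewrite mopp_fun in K. }
  assert (D' : forall p q y, anorm (aminus (madj (u p) y) (madj (u q) y))
      <= mnorm (mplus (u p) (mopp (u q))) * anorm y).
  { intros p q y.
    pose proof (madj_bound (mplus (u p) (mopp (u q))) _ y (mnormP _)) as K.
    change (madj (mplus (u p) (mopp (u q))) y)
      with (aplus (madj (u p) y) (ascal (Cconj (RtoC (-1))) (madj (u q) y))) in K.
    now rewrite Cconj_RtoC, ascalN1 in K. }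
  assert (C : forall f : nat -> A -> A,
    (forall p q y, anorm (aminus (f p y) (f q y)) <= mnorm (mplus (u p) (mopp (u q))) * anorm y) ->
    exists g : A -> A, forall y eps, 0 < eps -> exists N, forall p, (N <= p)%nat ->
      anorm (aminus (f p y) (g y)) < eps).
  { intros f Hf. apply functional_choice with (R := fun y l => forall eps, 0 < eps ->
      exists N, forall p, (N <= p)%nat -> anorm (aminus (f p y) l) < eps).
    intro y. apply anorm_complete. intros eps He.
    pose proof (anorm_ge0 y).
    destruct (H (eps / (anorm y + 1))) as [N HN]; [apply Rdiv_lt_0_compat; lra|].
    exists N. intros p q Hp Hq. specialize (HN p q Hp Hq).
    eapply Rle_lt_trans; [apply Hf|].
    pose proof (mnorm_ge0 (mplus (u p) (mopp (u q)))).
    apply Rle_lt_trans with (eps / (anorm y + 1) * anorm y); [nra|].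
    apply Rmult_lt_reg_r with (anorm y + 1); [lra|]. field_simplify; nra. }
  destruct (C _ D) as [g Hg]. destruct (C _ D') as [g' Hg'].
  assert (B : forall eps, 0 < eps -> exists N, forall p, (N <= p)%nat ->
     forall y, anorm (aminus (u p y) (g y)) <= eps * anorm y).
  { intros eps He. destruct (H eps He) as [N HN]. exists N. intros p Hp y.
    apply le_epsilon. intros e' He'.
    destruct (Hg y e' He') as [N' HN'].
    rewrite (aminus_trans _ _ (u (N + N')%nat y)).
    eapply Rle_trans; [apply anormD|].
    specialize (HN' (N + N')%nat ltac:(lia)).
    specialize (HN p (N + N')%nat Hp ltac:(lia)).
    pose proof (D p (N + N')%nat y). pose proof (anorm_ge0 y). nra. }
  assert (R : forall x y, cmul A (cstar A (g x)) y = cmul A (cstar A x) (g' y)).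
  { intros x y. apply aminus_eq0, anorm_small. intros eps He.
    pose proof (anorm_ge0 x). pose proof (anorm_ge0 y).
    set (d := eps / (anorm x + anorm y + 1)).
    assert (Hd : 0 < d) by (apply Rdiv_lt_0_compat; lra).
    assert (Ed : d * (anorm x + anorm y + 1) = eps) by (unfold d; field; lra).
    destruct (Hg x d Hd) as [N HN]. destruct (Hg' y d Hd) as [N' HN'].
    specialize (HN (N + N')%nat ltac:(lia)). specialize (HN' (N + N')%nat ltac:(lia)).
    set (p := (N + N')%nat) in *.
    rewrite (aminus_trans _ _ (cmul A (cstar A (u p x)) y)).
    eapply Rle_trans; [apply anormD|].
    rewrite <- acmulBl, <- acstarB, madjP, <- acmulBr.
    rewrite anorm_minus_sym in HN.
    pose proof (anorm_cmul (cstar A (aminus (g x) (u p x))) y) as K1.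
    pose proof (anorm_cmul (cstar A x) (aminus (madj (u p) y) (g' y))) as K2.
    rewrite anorm_cstar in K1, K2.
    pose proof (anorm_ge0 (aminus (g x) (u p x))).
    pose proof (anorm_ge0 (aminus (madj (u p) y) (g' y))). nra. }
  assert (Bd : exists c, forall y, anorm (g y) <= c * anorm y).
  { destruct (B 1) as [N HN]; [lra|]. specialize (HN N (le_n _)).
    exists (mnorm (u N) + 1). intro y.
    replace (g y) with (aminus (u N y) (aminus (u N y) (g y))).
    - change (anorm (aplus (u N y) (aopp (aminus (u N y) (g y)))) <= (mnorm (u N) + 1) * anorm y). eapply Rle_trans; [apply anormD|]. rewrite anormN.
      pose proof (mnormP (u N) y). specialize (HN y). lra.
    - change (aplus (u N y) (aopp (aminus (u N y) (g y))) = g y).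
      rewrite aoppB. change (aplus (u N y) (aplus (g y) (aopp (u N y))) = g y).
      now rewrite (aplusC (g y)), aplusA, aplusN, aplus0l. }
  exists (Build_multiplier A g g' R Bd). intros eps He.
  destruct (B (eps / 2)) as [N HN]; [lra|]. exists N. intros p Hp.
  apply Rle_lt_trans with (eps / 2); [|lra]. apply mnorm_le; [lra|]. intro y.
  change (mplus (u p) (mopp (Build_multiplier A g g' R Bd)) y)
    with (aplus (u p y) (mopp (Build_multiplier A g g' R Bd) y)).
  rewrite mopp_fun. now apply HN.
Qed.

End Multiplier.

Definition MA (A : CstarAlgebra) : UCstar.
Proof.
  refine (Build_UCstar (multiplier A) mzero mone (mscal Ci mone) mplus mopp mcomp
    (fun r => mscal (RtoC r)) mstar mnorm _ _ _ _ _ _ _ _ _ _ _ _ _ _ _ _ _ _ _ _ _ _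
    _ _ _ _ _ _ multiplier_complete).
  - intros. apply multiplier_eq. intro. apply aplusC.
  - intros. apply multiplier_eq. intro. apply aplusA.
  - intros. apply multiplier_eq. intro. apply aplus0.
  - intros. apply multiplier_eq. intro t. simpl. rewrite ascalN1. apply aplusN.
  - intros. now apply multiplier_eq.
  - intros. now apply multiplier_eq.
  - intros. now apply multiplier_eq.
  - intros. now apply multiplier_eq.
  - intros. apply multiplier_eq. intro t. simpl. apply mfun_plus.
  - intros. apply multiplier_eq. intro. apply ascal1.
  - intros. apply multiplier_eq. intro. apply ascal_plus.
  - intros. apply multiplier_eq. intro. apply ascalDr.
  - intros. apply multiplier_eq. intro. apply ascal_mult.
  - intros. now apply multiplier_eq.
  - intros. apply multiplier_eq. intro t. simpl. apply mfun_scal.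
  - intros. now apply multiplier_eq.
  - intros. now apply multiplier_eq.
  - intros. now apply multiplier_eq.
  - intros. apply multiplier_eq. intro t. simpl. now rewrite Cconj_RtoC.
  - apply multiplier_eq. intro t. simpl. rewrite ascalA. f_equal.
    unfold Ci, Cmult, RtoC. simpl. f_equal; ring.
  - apply multiplier_eq. intro t. simpl. rewrite ascalA. f_equal.
    unfold Ci, Cmult, RtoC, Cconj. simpl. f_equal; ring.
  - intros. apply multiplier_eq. intro t. simpl. symmetry. apply mfun_scal.
  - intros S T. apply mnorm_le.
    + pose proof (mnorm_ge0 S). pose proof (mnorm_ge0 T). lra.
    + intro y. eapply Rle_trans; [apply anormD|].
      pose proof (mnormP S y). pose proof (mnormP T y). lra.
  - intros S T. pose proof (mnorm_ge0 S). pose proof (mnorm_ge0 T).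
    apply mnorm_le; [nra|]. intro y. simpl. eapply Rle_trans; [apply mnormP|].
    pose proof (mnormP T y). rewrite Rmult_assoc. nra.
  - intros r S. pose proof (mnorm_ge0 S). pose proof (Rabs_pos r).
    apply mnorm_le; [nra|]. intro y. simpl. rewrite anorm_scal.
    pose proof (mnormP S y). rewrite Rmult_assoc. nra.
  - apply mnorm_ge0.
  - intros S H. apply multiplier_eq. intro t. simpl.
    apply anorm_eq0, Rle_antisym; [|apply anorm_ge0].
    pose proof (mnormP S t). rewrite H in *. lra.
  - intro S. pose proof (mnorm_ge0 S). apply Rle_antisym.
    + apply mnorm_le; [nra|]. intro y. simpl.
      eapply Rle_trans; [apply madj_bound, mnormP|].
      pose proof (mnormP S y). rewrite Rmult_assoc. nra.
    + set (T := mcomp (mstar S) S). pose proof (mnorm_ge0 T) as T0.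
      assert (L : mnorm S <= sqrt (mnorm T)).
      { apply mnorm_le; [apply sqrt_pos|]. intro y.
        rewrite <- (sqrt_square (anorm (S y))), <- (sqrt_square (anorm y)) by apply anorm_ge0.
        rewrite <- sqrt_mult by (easy || apply Rle_0_sqr || (pose proof (anorm_ge0 y); nra)).
        apply sqrt_le_1_alt. rewrite <- anorm_cstar_id, madjP.
        change (madj S (S y)) with (T y). eapply Rle_trans; [apply anorm_cmul|].
        rewrite anorm_cstar. pose proof (mnormP T y). pose proof (anorm_ge0 y). nra. }
      pose proof (sqrt_sqrt _ T0). nra.
Defined.

(** * The isometric embedding of the algebra into its multipliers *)

Section Embedding.
Context {A : CstarAlgebra}.
Implicit Types a b x y z : A.

Definition lmult_multiplier a : multiplier A.
Proof.
  exists (fun x => cmul A a x) (fun x => cmul A (cstar A a) x).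
  - intros. now rewrite cstar_cmul, cmul_assoc.
  - exists (anorm a). intro. apply anorm_cmul.
Defined.

Definition lmult a : MA A := lmult_multiplier a.

Lemma MA_eq (S T : MA A) : (forall x, mfun (S : multiplier A) x = mfun (T : multiplier A) x) -> S = T.
Proof. apply multiplier_eq. Qed.

Lemma lmult_plus a b : lmult (aplus a b) = (lmult a + lmult b)%U.
Proof. apply MA_eq. intro. simpl. apply acmulDl. Qed.

Lemma lmult_scal r a : lmult (ascal (RtoC r) a) = (r *: lmult a)%U.
Proof. apply MA_eq. intro. simpl. apply acmulZl. Qed.

Lemma lmult_opp a : lmult (aopp a) = (- lmult a)%U.
Proof. now rewrite <- ascalN1, lmult_scal, uscalN1. Qed.

Lemma lmult_minus a b : lmult (aminus a b) = (lmult a - lmult b)%U.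
Proof.
  change (lmult (aplus a (aopp b)) = (lmult a - lmult b)%U). now rewrite lmult_plus, lmult_opp.
Qed.

Lemma lmult_zero : lmult azero = 0%U.
Proof. rewrite <- (ascal0 azero), lmult_scal. apply uscal0. Qed.

Lemma lmult_cmul a b : lmult (cmul A a b) = (lmult a * lmult b)%U.
Proof. apply MA_eq. intro. simpl. apply cmul_assoc. Qed.

Lemma lmult_star a : lmult (cstar A a) = ((lmult a)^*)%U.
Proof. now apply MA_eq. Qed.

Lemma lmult_mfun (S : MA A) a : lmult (mfun (S : multiplier A) a) = (S * lmult a)%U.
Proof. apply MA_eq. intro. simpl. symmetry. apply mfun_cmul. Qed.

Lemma lmult_norm a : unorm (lmult a) = anorm a.
Proof.
  apply Rle_antisym.
  - apply mnorm_le; [apply anorm_ge0|]. intro. apply anorm_cmul.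
  - pose proof (mnormP (lmult a) (cstar A a)) as K. simpl in K.
    pose proof (anorm_cstar_id (cstar A a)) as N. rewrite cstar_invol in N.
    rewrite N, anorm_cstar in K.
    destruct (anorm_ge0 a) as [P|P].
    + apply Rmult_le_reg_r with (anorm a); easy.
    + rewrite <- P. apply unorm_ge0.
Qed.

Lemma lmult_inj a b : lmult a = lmult b -> a = b.
Proof.
  intro H. apply aminus_eq0, anorm_eq0.
  now rewrite <- lmult_norm, lmult_minus, H, uaddN, unorm0.
Qed.

End Embedding.

Global Hint Rewrite @lmult_plus @lmult_scal @lmult_opp @lmult_minus @lmult_zero
  @lmult_cmul @lmult_star : lmult.

(** * Closed ideals *)

Ltac aring := apply lmult_inj; autorewrite with lmult ustar; ucring.

Section Ideal.
Context {A : CstarAlgebra} (J : A -> Prop) (HJ : closed_ideal A J).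
Implicit Types a b x y z e : A.

Lemma ideal0 : J azero.
Proof. apply HJ. Qed.
Lemma idealD x y : J x -> J y -> J (aplus x y).
Proof. apply HJ. Qed.
Lemma idealZ (k : C) x : J x -> J (ascal k x).
Proof. apply HJ. Qed.
Lemma idealMl a x : J x -> J (cmul A a x).
Proof. apply HJ. Qed.
Lemma idealMr a x : J x -> J (cmul A x a).
Proof. apply HJ. Qed.
Lemma idealB x y : J x -> J y -> J (aminus x y).
Proof.
  intros Hx Hy. change (J (aplus x (aopp y))). rewrite <- ascalN1.
  now apply idealD; [|apply idealZ].
Qed.

Lemma ideal_closed x :
  (forall eps, 0 < eps -> exists y, J y /\ anorm (aminus x y) < eps) -> J x.
Proof.
  intro H.
  assert (Hn : forall n : nat, exists y, J y /\ anorm (aminus x y) < / (INR n + 1)).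
  { intro n. apply H, Rinv_0_lt_compat. pose proof (pos_INR n). lra. }
  destruct (functional_choice _ Hn) as [u Hu].
  destruct HJ as (_ & _ & _ & _ & cl).
  apply (cl u x); [intro n; apply Hu|].
  apply filterlim_locally. intro eps.
  destruct (INR_unbounded (/ eps)) as [N HN].
  exists N. intros n Hn'. apply (norm_compat1 (V := A)).
  change (anorm (aminus (u n) x) < eps). rewrite anorm_minus_sym.
  eapply Rlt_trans; [apply Hu|].
  pose proof (cond_pos eps). apply le_INR in Hn'.
  rewrite <- (Rinv_inv eps). pose proof (Rinv_0_lt_compat eps H0).
  apply Rinv_lt_contravar; nra.
Qed.

(** This is [1 - (1 - h)^n] written without the unit, so that membership in the ideal follows by
    induction. *)
Fixpoint approx_unit_seq (h : A) (n : nat) : A :=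
  match n with
  | O => azero
  | S n => aplus (approx_unit_seq h n) (aminus h (cmul A h (approx_unit_seq h n)))
  end.

Lemma lmult_approx_unit_seq h n :
  lmult (approx_unit_seq h n) = (1 - upow (1 - lmult h) n)%U.
Proof.
  induction n as [|n IH]; cbn [approx_unit_seq upow]; autorewrite with lmult; [ucring|].
  rewrite IH. ucring.
Qed.

(** A unit adapted to the single element [x]. After scaling to [|x| <= 1], put [h = x^* x] and
    [e = 1 - (1 - h)^n]. Then [|x - x e|^2 = |h (1 - h)^(2n)| <= 1 / (2n)] by [unorm_decay]. *)
Lemma approx_unit x eps : J x -> 0 < eps ->
  exists e, J e /\ cstar A e = e /\ anorm (aminus x (cmul A x e)) < eps.
Proof.
  assert (main : forall x eps, anorm x <= 1 -> J x -> 0 < eps ->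
    exists e, J e /\ cstar A e = e /\ anorm (aminus x (cmul A x e)) < eps).
  { clear x eps. intros x eps Nx Hx He. set (h := cmul A (cstar A x) x).
    destruct (INR_unbounded (/ (eps * eps))) as [n Hn].
    set (X := lmult x). set (H := lmult h).
    assert (EH : H = (X^* * X)%U) by (unfold H, h, X; now autorewrite with lmult).
    set (Q := upow (1 - H)%U n).
    assert (SH : (H^*)%U = H) by (rewrite EH; now autorewrite with ustar).
    assert (SQ : (Q^*)%U = Q).
    { apply upow_star. autorewrite with ustar. now rewrite SH. }
    exists (approx_unit_seq h n). split; [|split].
    - clear - HJ Hx. induction n as [|n IH]; simpl; [apply ideal0|].
      assert (J h) by now apply idealMl.
      apply idealD; [easy|]. apply idealB; [easy|]. now apply idealMl.
    - apply lmult_inj. rewrite lmult_star, lmult_approx_unit_seq. fold H Q.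
      autorewrite with ustar. now rewrite SQ.
    - rewrite <- lmult_norm. autorewrite with lmult. rewrite lmult_approx_unit_seq.
      fold X H Q. replace (X - X * (1 - Q))%U with (X * Q)%U by ucring.
      set (d := unorm (X * Q)%U).
      assert (D : d * d = unorm (H * upow (1 - H) (n + n))%U).
      { unfold d. rewrite <- unorm_Cstar, ustarM, SQ. f_equal.
        rewrite upow_add. fold Q. assert (ucomm H Q) by (unfold Q; auto with ucomm).
        transitivity (Q * (X^* * X) * Q)%U; [ucring|]. rewrite <- EH. ucomring. }
      pose proof (unorm_decay H (n + n)) as K. rewrite <- D, plus_INR in K.
      assert (P : upos H) by (rewrite EH; apply upos_star_mul).
      assert (NH : unorm H <= 1).
      { rewrite EH, unorm_Cstar. unfold X. rewrite lmult_norm.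
        pose proof (anorm_ge0 x). nra. }
      specialize (K P NH). apply Rnot_le_lt. intro L.
      assert (1 < INR n * (eps * eps)).
      { replace 1 with (/ (eps * eps) * (eps * eps)) by (field; lra).
        apply Rmult_lt_compat_r; nra. }
      pose proof (pos_INR n). assert (eps * eps <= d * d) by nra. nra. }
  intros Hx He. pose proof (anorm_ge0 x). set (a := anorm x + 1).
  assert (Ha : 0 < a) by (unfold a; lra).
  destruct (main (ascal (RtoC (/ a)) x) (eps / a)) as [e [Je [Se Ne]]].
  - rewrite anorm_scal, Rabs_inv, Rabs_pos_eq by lra.
    apply Rmult_le_reg_l with a; [easy|]. rewrite <- Rmult_assoc, Rinv_r; unfold a; lra.
  - now apply idealZ.
  - now apply Rdiv_lt_0_compat.
  - exists e. split; [easy|split; [easy|]].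
    replace (aminus x (cmul A x e)) with
      (ascal (RtoC a) (aminus (ascal (RtoC (/ a)) x) (cmul A (ascal (RtoC (/ a)) x) e)))
      by aring.
    rewrite anorm_scal, Rabs_pos_eq by lra.
    apply Rlt_le_trans with (a * (eps / a)); [nra|]. right. field. lra.
Qed.

(** With [e] self-adjoint in [J], [x^*] is a limit of elements [e x^*]. *)
Lemma ideal_star x : J x -> J (cstar A x).
Proof.
  intro Hx. apply ideal_closed. intros eps He.
  destruct (approx_unit x eps Hx He) as [e [Je [Se Ne]]].
  exists (cmul A e (cstar A x)). split; [now apply idealMr|].
  rewrite <- anorm_cstar, acstarB, cstar_cmul, !cstar_invol, Se. easy.
Qed.

(** [S x] is nearly [S (x e) = S x e] with [e] in [J]. It is needed for operators obtained from
    square roots, which live only in the multiplier algebra. *)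
Lemma ideal_multiplier (S : multiplier A) x : J x -> J (S x).
Proof.
  intro Hx. apply ideal_closed. intros eps He.
  pose proof (mnorm_ge0 S).
  destruct (approx_unit x (eps / (mnorm S + 1)) Hx) as [e [Je [_ Ne]]].
  { apply Rdiv_lt_0_compat; lra. }
  exists (cmul A (S x) e). split; [now apply idealMl|].
  rewrite <- mfun_cmul.
  replace (aminus (S x) (S (cmul A x e))) with (S (aminus x (cmul A x e))).
  - eapply Rle_lt_trans; [apply mnormP|]. pose proof (anorm_ge0 (aminus x (cmul A x e))).
    apply Rle_lt_trans with (mnorm S * (eps / (mnorm S + 1))); [nra|].
    apply Rmult_lt_reg_r with (mnorm S + 1); [lra|]. field_simplify; lra.
  - change (S (aplus x (aopp (cmul A x e))) = aplus (S x) (aopp (S (cmul A x e)))).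
    now rewrite mfun_plus, <- !ascalN1, mfun_scal.
Qed.

End Ideal.

Lemma ustar_mul_eq0 {U : UCstar} (x : U) : (x^* * x)%U = 0%U -> x = 0%U.
Proof.
  intro H. apply unorm_eq0. pose proof (unorm_Cstar U x) as N.
  rewrite H, unorm0 in N. nra.
Qed.

Lemma essential0 {A : CstarAlgebra} (J : A -> Prop) : essential_ideal A J ->
  forall a, (forall x, J x -> cmul A a x = azero) -> a = azero.
Proof. intros [_ H]. exact H. Qed.

(* If [H = b^* b] had norm greater than 1, the operator [f = |H - 1| + (H - 1)]
   would satisfy [f H <> 0]. But [H f = (1 + K) f] with [K = |H - 1|], so on the
   elements [f x], [x] in [J], boundedness of the powers of [H] forces [K f x = 0]
   and then [f x = 0]; hence the element [f H] of [A] annihilates [J]. *)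
Lemma essential_norm_le1 {A : CstarAlgebra} (J : A -> Prop) (b : A) :
  essential_ideal A J ->
  (forall x, J x -> anorm (cmul A b x) <= anorm x) -> anorm b <= 1.
Proof.
  intros HE Hb. pose proof (proj1 HE) as HJ.
  (* With [y = b^* z] in [J], [|y|^2 = |z^* b y| <= |z| |y|]. *)
  assert (Hb' : forall z, J z -> anorm (cmul A (cstar A b) z) <= anorm z).
  { intros z Hz. set (y := cmul A (cstar A b) z).
    assert (Jy : J y) by now apply idealMl.
    destruct (anorm_ge0 y) as [P|P]; [|rewrite <- P; apply anorm_ge0].
    apply Rmult_le_reg_r with (anorm y); [easy|].
    rewrite <- anorm_cstar_id. unfold y at 1. rewrite cstar_cmul, cstar_invol, cmul_assoc.
    eapply Rle_trans; [apply anorm_cmul|]. rewrite anorm_cstar.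
    pose proof (Hb y Jy). pose proof (anorm_ge0 z). nra. }
  set (h := cmul A (cstar A b) b).
  assert (Hh : forall z, J z -> anorm (cmul A h z) <= anorm z).
  { intros z Hz. unfold h. rewrite cmul_assoc.
    eapply Rle_trans; [apply Hb', idealMl; easy|]. now apply Hb. }
  set (H := lmult h).
  assert (EH : H = ((lmult b)^* * lmult b)%U) by (unfold H, h; now autorewrite with lmult).
  assert (PH : upos H) by (rewrite EH; apply upos_star_mul).
  pose proof PH as [SH _].
  set (G := (H - 1)%U).
  assert (SG : (G^*)%U = G) by (unfold G; autorewrite with ustar; now rewrite SH).
  destruct (upos_sqrt (G * G)%U (upos_sq G SG)) as [K [PK [EK CK]]].
  pose proof PK as [SK _].
  assert (CHG : ucomm H G) by (unfold G; auto with ucomm).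
  assert (CHK : ucomm H K) by (apply CK; auto with ucomm).
  assert (CKG : ucomm K G) by (unfold G; auto with ucomm).
  destruct (upos_sqrt K PK) as [r [[Sr _] [Er Cr]]].
  assert (CrH : ucomm H r) by now apply Cr.
  set (f := (K + G)%U).
  assert (Sf : (f^*)%U = f) by (unfold f; now rewrite ustarD, SK, SG).
  assert (CHf : ucomm H f) by (unfold f; auto with ucomm).
  assert (CKf : ucomm K f) by (unfold f; auto with ucomm).
  assert (GKf : (G * f)%U = (K * f)%U).
  { unfold f. rewrite !umulDr, EK, CKG. apply uaddC. }
  assert (HKf : (H * f)%U = ((1 + K) * f)%U).
  { replace H with (1 + G)%U by (unfold G; ucring). now rewrite !umulDl, GKf. }
  assert (Pow : forall n, (upow H n * f)%U = (upow (1 + K)%U n * f)%U).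
  { intro n. induction n as [|n IH]; cbn [upow]; [easy|].
    rewrite <- umulA, IH, umulA.
    assert (C : ucomm H (upow (1 + K)%U n)) by auto with ucomm.
    rewrite C, <- umulA, HKf.
    assert (C' : ucomm (1 + K)%U (upow (1 + K)%U n)) by auto with ucomm.
    now rewrite umulA, C'. }
  assert (Bd : forall n z, J z -> unorm (upow H n * lmult z)%U <= anorm z).
  { intro n. induction n as [|n IH]; intros z Hz; cbn [upow].
    - rewrite umul1l, lmult_norm. lra.
    - assert (C : ucomm H (upow H n)) by auto with ucomm.
      rewrite C, <- umulA. unfold H at 2. rewrite <- lmult_cmul.
      eapply Rle_trans; [apply IH; now apply idealMl|]. now apply Hh. }
  assert (KfX : forall x, J x -> (K * (f * lmult x))%U = 0%U).
  { intros x Hx. set (z := mfun (f : multiplier A) x).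
    assert (Jz : J z) by now apply ideal_multiplier.
    assert (Ez : lmult z = (f * lmult x)%U) by apply lmult_mfun.
    rewrite <- Ez. set (Z := lmult z) in *.
    (* By Bernoulli, [2n Z^* K Z] lies below [Z^* (1 + K)^(2n) Z], whose norm is
       [|(1 + K)^n Z|^2 = |H^n Z|^2]. *)
    assert (N : forall n, INR (n + n) * unorm (Z^* * K * Z)%U <= anorm z * anorm z).
    { intro n. set (P := upow (1 + K)%U n).
      assert (SP : (P^*)%U = P).
      { apply upow_star. autorewrite with ustar. now rewrite SK. }
      assert (NP : unorm (P * Z)%U <= anorm z).
      { rewrite Ez, umulA. unfold P. rewrite <- Pow, <- umulA, <- Ez. now apply Bd. }
      pose proof (pos_INR (n + n)).
      rewrite <- (Rabs_pos_eq (INR (n + n))), <- unormZ by easy.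
      apply Rle_trans with (unorm (Z^* * upow (1 + K) (n + n) * Z)%U).
      - apply upos_mono.
        + apply upos_scal; [easy|]. now apply upos_conj.
        + replace (Z^* * upow (1 + K) (n + n) * Z - INR (n + n) *: (Z^* * K * Z))%U
            with (Z^* * (upow (1 + K) (n + n) - 1 - INR (n + n) *: K) * Z + Z^* * Z)%U
            by ucring.
          apply upos_add; [|apply upos_star_mul].
          apply upos_conj. now apply upos_pow_succ.
      - rewrite upow_add. fold P.
        replace (Z^* * (P * P) * Z)%U with ((P * Z)^* * (P * Z))%U
          by (rewrite ustarM, SP; ucring).
        rewrite unorm_Cstar. pose proof (unorm_ge0 _ (P * Z)%U). nra. }
    assert (Z0 : unorm (Z^* * K * Z)%U = 0).
    { set (d := unorm (Z^* * K * Z)%U) in *. pose proof (unorm_ge0 _ (Z^* * K * Z)%U : 0 <= d).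
      apply Rle_antisym; [|easy]. apply Rnot_lt_le. intro P.
      destruct (INR_unbounded (anorm z * anorm z / d)) as [n Hn].
      specialize (N n). rewrite plus_INR in N. pose proof (pos_INR n).
      assert (anorm z * anorm z < INR n * d).
      { replace (anorm z * anorm z) with (anorm z * anorm z / d * d) by (field; lra).
        now apply Rmult_lt_compat_r. }
      nra. }
    assert (rZ : (r * Z)%U = 0%U).
    { apply ustar_mul_eq0, unorm_eq0. rewrite <- Z0, ustarM, Sr, <- Er.
      f_equal. ucring. }
    now rewrite <- Er, <- umulA, rZ, umul0r. }
  (* [f^2 = K f + G f], and [G f = K f], so [f^2] annihilates [J]. As [f] is self-adjoint, so does
     [f]. *)
  assert (fX : forall x, J x -> (f * lmult x)%U = 0%U).
  { intros x Hx. apply ustar_mul_eq0. rewrite ustarM, Sf.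
    assert (E : (f * (f * lmult x))%U = 0%U).
    { replace (f * (f * lmult x))%U with (K * (f * lmult x) + (G * f) * lmult x)%U
        by (unfold f at 3; ucring).
      rewrite GKf, <- umulA, KfX by easy. apply uadd0. }
    now rewrite <- umulA, E, umul0r. }
  assert (fH : (f * H)%U = 0%U).
  { assert (E : mfun (f : multiplier A) h = azero).
    { apply (essential0 J HE). intros x Hx. apply lmult_inj.
      rewrite lmult_cmul, lmult_mfun, <- umulA, <- lmult_cmul, fX by now apply idealMl.
      now rewrite lmult_zero. }
    pose proof (lmult_mfun f h) as L. rewrite E, lmult_zero in L. now symmetry. }
  (* [f H = 0] reads [K H = - G H = H - H^2]. Thus [H^2] lies below [H], and comparing norms gives
     [|H|^2 <= |H|]. *)
  assert (EKH : (H - H * H)%U = (r^* * H * r)%U).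
  { rewrite Sr. replace (r * H * r)%U with (K * H)%U by (rewrite <- Er; ucomring).
    replace (K * H)%U with (f * H - G * H)%U by (unfold f; ucring).
    rewrite fH. unfold G. ucring. }
  assert (NH : unorm H * unorm H <= unorm H).
  { rewrite <- unorm_selfadj_sq by easy. apply upos_mono; [now apply upos_sq|].
    rewrite EKH. now apply upos_conj. }
  assert (NHb : unorm H = anorm b * anorm b) by (rewrite EH, unorm_Cstar, lmult_norm; easy).
  pose proof (anorm_ge0 b). rewrite NHb in NH.
  apply Rnot_lt_le. intro L.
  assert (1 < anorm b * anorm b) by nra. nra.
Qed.

Lemma essential_norm_le {A : CstarAlgebra} (J : A -> Prop) (b : A) (c : R) :
  essential_ideal A J -> 0 <= c ->
  (forall x, J x -> anorm x <= 1 -> anorm (cmul A b x) <= c) -> anorm b <= c.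
Proof.
  intros HE Hc H1. pose proof (proj1 HE) as HJ.
  assert (H : forall x, J x -> anorm (cmul A b x) <= c * anorm x).
  { intros x Hx. destruct (anorm_ge0 x) as [P|P].
    - specialize (H1 (ascal (RtoC (/ anorm x)) x)).
      rewrite acmulZr, !anorm_scal, Rabs_inv, Rabs_pos_eq in H1 by lra.
      apply Rmult_le_reg_l with (/ anorm x); [now apply Rinv_0_lt_compat|].
      replace (/ anorm x * (c * anorm x)) with c by (field; lra).
      apply H1; [now apply idealZ|]. rewrite Rinv_l; lra.
    - rewrite <- P. symmetry in P. apply anorm_eq0 in P. subst x.
      rewrite acmul0r, anorm0. lra. }
  destruct (Req_dec c 0) as [->|Nc].
  - rewrite (essential0 J HE b); [rewrite anorm0; lra|]. intros x Hx.
    apply anorm_eq0, Rle_antisym; [|apply anorm_ge0]. specialize (H x Hx). lra.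
  - assert (L : anorm (ascal (RtoC (/ c)) b) <= 1).
    { apply (essential_norm_le1 J); [easy|]. intros x Hx.
      rewrite acmulZl, anorm_scal, Rabs_inv, Rabs_pos_eq by lra.
      apply Rmult_le_reg_l with c; [lra|]. rewrite <- Rmult_assoc, Rinv_r, Rmult_1_l by easy.
      now apply H. }
    rewrite anorm_scal, Rabs_inv, Rabs_pos_eq in L by lra.
    apply Rmult_le_reg_l with (/ c); [apply Rinv_0_lt_compat; lra|].
    rewrite Rinv_l; lra.
Qed.

(** * Hilbert modules *)

Section HilbertModule.
Context {A : CstarAlgebra} {M : HilbertModule A}.
Implicit Types m n k l : M.
Implicit Types a b x : A.

Definition hzero : M := zero.
Definition hplus m n : M := plus m n.
Definition hminus m n : M := minus m n.
Definition hscal (c : C) m : M := scal c m.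

Lemma hminusE m n : hminus m n = hplus m (hscal (RtoC (-1)) n).
Proof. unfold hscal. rewrite scal_RtoC_N1. reflexivity. Qed.
Lemma hscal0 m : hscal (RtoC 0) m = hzero.
Proof. exact (scal_RtoC_0 m). Qed.
Lemma hminus_eq0 m n : hminus m n = hzero -> m = n.
Proof. exact (minus_eq0 m n). Qed.

Lemma ipDr m n n' : ip M m (hplus n n') = aplus (ip M m n) (ip M m n').
Proof. exact (ip_plus_r A M m n n'). Qed.
Lemma ipZr m (c : C) n : ip M m (hscal c n) = ascal c (ip M m n).
Proof. exact (ip_scal_r A M c m n). Qed.
Lemma ip_actr m n a : ip M m (ract M n a) = cmul A (ip M m n) a.
Proof. exact (ip_ract_r A M m n a). Qed.
Lemma ipC m n : ip M n m = cstar A (ip M m n).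
Proof. exact (ip_sym A M m n). Qed.
Lemma ipDl m n n' : ip M (hplus n n') m = aplus (ip M n m) (ip M n' m).
Proof. now rewrite ipC, ipDr, acstarD, <- !ipC. Qed.
Lemma ipZl m (c : C) n : ip M (hscal c n) m = ascal (Cconj c) (ip M n m).
Proof. now rewrite ipC, ipZr, acstarZ, <- !ipC. Qed.
Lemma ipZlR m (r : R) n : ip M (hscal (RtoC r) n) m = ascal (RtoC r) (ip M n m).
Proof. now rewrite ipZl, Cconj_RtoC. Qed.
Lemma ip_actl m n a : ip M (ract M n a) m = cmul A (cstar A a) (ip M n m).
Proof. now rewrite ipC, ip_actr, cstar_cmul, <- !ipC. Qed.
Lemma ipBr m n n' : ip M m (hminus n n') = aminus (ip M m n) (ip M m n').
Proof. rewrite hminusE, ipDr, ipZr, ascalN1. reflexivity. Qed.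
Lemma ipBl m n n' : ip M (hminus n n') m = aminus (ip M n m) (ip M n' m).
Proof. rewrite hminusE, ipDl, ipZlR, ascalN1. reflexivity. Qed.
Lemma ip0r m : ip M m hzero = azero.
Proof. now rewrite <- (hscal0 hzero), ipZr, ascal0. Qed.
Lemma ip0l m : ip M hzero m = azero.
Proof. now rewrite ipC, ip0r, acstar0. Qed.

Lemma ip_ext m n : (forall k, ip M k m = ip M k n) -> m = n.
Proof.
  intro H. apply hminus_eq0, (ip_definite A M).
  change (ip M (hminus m n) (hminus m n) = azero).
  now rewrite ipBr, H, aminus_diag.
Qed.

End HilbertModule.

Global Hint Rewrite @ipDr @ipDl @ipZr @ipZlR @ip_actr @ip_actl @ipBr @ipBl @ip0r @ip0l : hip.
Ltac hring := apply ip_ext; intro; autorewrite with hip; aring.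

(** * Cauchy-Schwarz and the module norm *)

Section Norm.
Context {A : CstarAlgebra} {M : HilbertModule A}.
Implicit Types m n k l : M.
Implicit Types a b x : A.

Lemma Mnorm_sq m : Mnorm M m * Mnorm M m = anorm (ip M m m).
Proof. apply sqrt_sqrt, anorm_ge0. Qed.

Lemma Mnorm_ge0 m : 0 <= Mnorm M m.
Proof. apply sqrt_pos. Qed.

Lemma Mnorm_le m c : 0 <= c -> anorm (ip M m m) <= c * c -> Mnorm M m <= c.
Proof. intros Hc H. rewrite <- Mnorm_sq in H. pose proof (Mnorm_ge0 m). nra. Qed.

Lemma Mnorm_eq0 m : Mnorm M m = 0 -> m = hzero.
Proof.
  intro H. apply (ip_definite A M), anorm_eq0. rewrite <- Mnorm_sq, H. ring.
Qed.

Lemma Mnorm0 : Mnorm M hzero = 0.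
Proof.
  apply Rle_antisym; [|apply Mnorm_ge0]. apply Mnorm_le; [lra|].
  rewrite ip0r, anorm0. lra.
Qed.

Lemma Mnorm_scalR r m : Mnorm M (hscal (RtoC r) m) = Rabs r * Mnorm M m.
Proof.
  apply Rsqr_inj; [apply Mnorm_ge0| |].
  - apply Rmult_le_pos; [apply Rabs_pos|apply Mnorm_ge0].
  - unfold Rsqr. rewrite Mnorm_sq, ipZr, ipZlR, !anorm_scal, <- Mnorm_sq. ring.
Qed.

Lemma Mnorm_scal (c : C) m : Mnorm M (hscal c m) <= Cmod c * Mnorm M m.
Proof.
  pose proof (Mnorm_ge0 m). pose proof (Cmod_ge_0 c).
  apply Mnorm_le; [nra|]. rewrite ipZr, ipZl.
  eapply Rle_trans; [apply anormZ_le|].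
  assert (E : Cmod (Cconj c) = Cmod c).
  { unfold Cmod, Cconj. simpl. f_equal. ring. }
  pose proof (anormZ_le (Cconj c) (ip M m m)) as L. rewrite E, <- Mnorm_sq in L. nra.
Qed.

(* [<m,m> = a^*a + (k a)^*(k a) + b^*b] with [a = <n,m>], [k^2 = 1 - <n,n>] and
   [b^*b = <m - n a, m - n a>]. *)
Lemma cauchy_schwarz_unit m n : anorm (ip M n n) <= 1 ->
  anorm (ip M n m) * anorm (ip M n m) <= anorm (ip M m m).
Proof.
  intro Hn. set (a := ip M n m). set (N := lmult (ip M n n)).
  assert (SN : (N^*)%U = N) by (unfold N; rewrite <- lmult_star, <- ipC; easy).
  destruct (usqrt1 N SN) as [k [[Sk _] [Ek _]]]; [unfold N; now rewrite lmult_norm|].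
  destruct (ip_pos A M (hminus m (ract M n a))) as [b Hb].
  set (B := lmult b). set (a' := lmult a).
  assert (E : (lmult (ip M m m) - a'^* * a')%U = (B^* * B + (k * a')^* * (k * a'))%U).
  { unfold B. rewrite <- lmult_star, <- lmult_cmul, <- Hb.
    autorewrite with hip. rewrite (ipC n m). fold a. autorewrite with lmult. fold a' N.
    rewrite ustarM, Sk.
    transitivity (lmult (ip M m m) - a'^* * a' - a'^* * a' + a'^* * N * a'
      + a'^* * (1 - N) * a')%U; [ucring|]. rewrite <- Ek. ucring. }
  rewrite <- anorm_cstar_id, <- !lmult_norm. autorewrite with lmult. fold a'.
  apply upos_mono; [apply upos_star_mul|]. rewrite E.
  apply upos_add; apply upos_star_mul.
Qed.

Lemma cauchy_schwarz m n : anorm (ip M n m) <= Mnorm M n * Mnorm M m.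
Proof.
  pose proof (Mnorm_ge0 m). pose proof (Mnorm_ge0 n).
  destruct (Req_dec (Mnorm M n) 0) as [Z|Z].
  - apply Mnorm_eq0 in Z. subst n. rewrite ip0l, anorm0. nra.
  - set (t := Mnorm M n) in *. assert (P : 0 < t) by lra.
    pose proof (cauchy_schwarz_unit m (hscal (RtoC (/ t)) n)) as K.
    rewrite !ipZlR, ipZr, !anorm_scal, <- !Mnorm_sq, Rabs_inv, (Rabs_pos_eq t) in K by lra.
    fold t in K.
    assert (K1 : / t * (/ t * (t * t)) <= 1) by (right; field; lra). specialize (K K1).
    apply Rmult_le_reg_l with (/ t); [now apply Rinv_0_lt_compat|].
    replace (/ t * (t * Mnorm M m)) with (Mnorm M m) by (field; lra).
    pose proof (anorm_ge0 (ip M n m)). pose proof (Rinv_0_lt_compat _ P).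
    assert (0 <= / t * anorm (ip M n m)) by nra. nra.
Qed.

Lemma Mnorm_triangle m n : Mnorm M (hplus m n) <= Mnorm M m + Mnorm M n.
Proof.
  pose proof (Mnorm_ge0 m). pose proof (Mnorm_ge0 n).
  apply Mnorm_le; [lra|]. rewrite ipDr, !ipDl.
  pose proof (cauchy_schwarz m m). pose proof (cauchy_schwarz n m).
  pose proof (cauchy_schwarz m n). pose proof (cauchy_schwarz n n).
  eapply Rle_trans; [apply anormD|].
  pose proof (anormD (ip M m m) (ip M n m)). pose proof (anormD (ip M m n) (ip M n n)).
  nra.
Qed.

Lemma Mnorm_minus_sym m n : Mnorm M (hminus m n) = Mnorm M (hminus n m).
Proof.
  replace (hminus m n) with (hscal (RtoC (-1)) (hminus n m)) by hring.
  rewrite Mnorm_scalR, Rabs_left; lra.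
Qed.

Lemma Mnorm_minus_triangle m n k :
  Mnorm M (hminus m n) <= Mnorm M (hminus m k) + Mnorm M (hminus k n).
Proof.
  replace (hminus m n) with (hplus (hminus m k) (hminus k n)) by hring.
  apply Mnorm_triangle.
Qed.

Lemma Mnorm_act m a : Mnorm M (ract M m a) <= Mnorm M m * anorm a.
Proof.
  pose proof (Mnorm_ge0 m). pose proof (anorm_ge0 a).
  apply Mnorm_le; [nra|]. rewrite ip_actr, ip_actl.
  eapply Rle_trans; [apply anorm_cmul|].
  pose proof (anorm_cmul (cstar A a) (ip M m m)) as L.
  rewrite anorm_cstar, <- Mnorm_sq in L. nra.
Qed.

Lemma Mnorm_le_dual n c : 0 <= c ->
  (forall k, anorm (ip M k n) <= c * Mnorm M k) -> Mnorm M n <= c.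
Proof.
  intros Hc H. destruct (Mnorm_ge0 n) as [P|P]; [|lra].
  apply Rmult_le_reg_r with (Mnorm M n); [easy|]. rewrite Mnorm_sq. apply H.
Qed.

End Norm.

(** * Bounded functionals and uniform boundedness *)

Section Dual.
Context {A : CstarAlgebra} {M : HilbertModule A}.
Implicit Types m n k l : M.
Implicit Types a b x : A.
Implicit Types f g : M -> A.

Lemma dualD f m n : in_Mdual M f -> f (hplus m n) = aplus (f m) (f n).
Proof. intro H. apply H. Qed.
Lemma dualZ f (c : C) m : in_Mdual M f -> f (hscal c m) = ascal (Cconj c) (f m).
Proof. intro H. apply H. Qed.
Lemma dualZR f (r : R) m : in_Mdual M f -> f (hscal (RtoC r) m) = ascal (RtoC r) (f m).
Proof. intro H. now rewrite dualZ, Cconj_RtoC. Qed.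
Lemma dual_act f m a : in_Mdual M f -> f (ract M m a) = cmul A (cstar A a) (f m).
Proof. intro H. apply H. Qed.
Lemma dual_bound f : in_Mdual M f ->
  exists c, 0 <= c /\ forall m, anorm (f m) <= c * Mnorm M m.
Proof.
  intros (_ & _ & _ & c & H). exists (Rabs c). split; [apply Rabs_pos|].
  intro m. eapply Rle_trans; [apply H|]. pose proof (Mnorm_ge0 m).
  pose proof (Rle_abs c). nra.
Qed.

Lemma hat_dual n : in_Mdual M (hat M n).
Proof.
  unfold hat. split; [|split; [|split]].
  - intros. apply ipDl.
  - intros. apply ipZl.
  - intros. apply ip_actl.
  - exists (Mnorm M n). intro m. rewrite Rmult_comm. apply cauchy_schwarz.
Qed.

(** [F] is conjugate-linear in its second variable and linear in its first. Taking the adjoint of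
    the values lets [in_Mdual] express both. *)
Lemma flip_dualD (F : M -> M -> A) m n k : in_Mdual M (fun m => cstar A (F m k)) ->
  F (hplus m n) k = aplus (F m k) (F n k).
Proof.
  intro H. pose proof (dualD _ m n H) as E. simpl in E.
  rewrite <- acstarD in E. now rewrite <- (cstar_invol A (F (hplus m n) k)), E, cstar_invol.
Qed.

Lemma flip_dualZR (F : M -> M -> A) (r : R) m k : in_Mdual M (fun m => cstar A (F m k)) ->
  F (hscal (RtoC r) m) k = ascal (RtoC r) (F m k).
Proof.
  intro H. pose proof (dualZR _ r m H) as E. simpl in E.
  now rewrite <- (cstar_invol A (F (hscal (RtoC r) m) k)), E, acstarZ, Cconj_RtoC, cstar_invol.
Qed.

Lemma flip_dualB (F : M -> M -> A) m n k : in_Mdual M (fun m => cstar A (F m k)) ->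
  F (hminus m n) k = aminus (F m k) (F n k).
Proof. intro H. rewrite hminusE, flip_dualD, flip_dualZR, ascalN1 by easy. reflexivity. Qed.

Lemma flip_dual_act (F : M -> M -> A) m x k : in_Mdual M (fun m => cstar A (F m k)) ->
  F (ract M m x) k = cmul A (F m k) x.
Proof.
  intro H. pose proof (dual_act _ m x H) as E. simpl in E.
  now rewrite <- (cstar_invol A (F (ract M m x) k)), E, cstar_cmul, !cstar_invol.
Qed.

(* Otherwise a sequence of nested balls, the [n]-th of which makes some [F _ k]
   with [k] in the unit ball larger than [n], shrinks to an [l] such that [F l]
   is unbounded. *)
Lemma separately_bounded (F : M -> M -> A) :
  (forall m, in_Mdual M (F m)) ->
  (forall k, in_Mdual M (fun m => cstar A (F m k))) ->
  exists c, 0 <= c /\ forall m k, anorm (F m k) <= c * Mnorm M m * Mnorm M k.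
Proof.
  intros HF HG.
  pose proof (fun m n k => flip_dualD F m n k (HG k)) as FD.
  pose proof (fun r m k => flip_dualZR F r m k (HG k)) as FZ.
  pose proof (fun m n k => flip_dualB F m n k (HG k)) as FB.
  assert (F0 : forall k, F hzero k = azero).
  { intro k. rewrite <- (hscal0 hzero), FZ. apply ascal0. }
  apply NNPP. intro N.
  assert (unb : forall c, 0 <= c -> exists k m, Mnorm M k <= 1 /\ c * Mnorm M m < anorm (F m k)).
  { intros c Hc. apply NNPP. intro N'. apply N. exists c. split; [easy|]. intros m k.
    destruct (Req_dec (Mnorm M k) 0) as [Z|Z].
    - apply Mnorm_eq0 in Z. subst k.
      pose proof (dualZR _ 0 hzero (HF m)) as E. rewrite hscal0, ascal0 in E.
      rewrite E, anorm0, Mnorm0. lra.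
    - pose proof (Mnorm_ge0 k). assert (P : 0 < Mnorm M k) by lra.
      apply Rnot_lt_le. intro L. apply N'.
      exists (hscal (RtoC (/ Mnorm M k)) k), m.
      rewrite Mnorm_scalR, dualZR, anorm_scal, Rabs_inv, Rabs_pos_eq by (easy || lra).
      split; [rewrite Rinv_l; lra|].
      apply Rmult_lt_reg_l with (Mnorm M k); [easy|].
      rewrite <- Rmult_assoc, <- Rmult_assoc, Rinv_r, Rmult_1_l by easy. lra. }
  (* Stated for every centre, radius and index, with positivity of the radius as a premise inside
     the existential, so that choice yields a total successor function. *)
  assert (step : forall p : (M * R) * nat, exists q : M * R, 0 < snd (fst p) ->
    0 < snd q /\ Mnorm M (hminus (fst q) (fst (fst p))) + snd q <= snd (fst p) /\
    snd q <= snd (fst p) / 2 /\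
    exists k, Mnorm M k <= 1 /\
      forall y, Mnorm M (hminus y (fst q)) <= snd q -> INR (snd p) <= anorm (F y k)).
  { intros [[x r] n]. simpl. destruct (Rle_or_lt r 0) as [L|Hr].
    { exists (x, r). intro. lra. }
    pose proof (pos_INR n).
    (* Rescaling [m] to norm [r / 2] produces [xi] with [|F xi k| >= 2 (n + 1)]. *)
    destruct (unb (4 * (INR n + 1) / r)) as [k [m [Hk Hm]]].
    { apply Rmult_le_pos; [lra|]. apply Rlt_le, Rinv_0_lt_compat, Hr. }
    assert (Pm : 0 < Mnorm M m).
    { destruct (Mnorm_ge0 m) as [P|P]; [easy|]. exfalso. symmetry in P.
      apply Mnorm_eq0 in P. subst m. rewrite F0, anorm0, Mnorm0 in Hm. lra. }
    set (xi := hscal (RtoC (r / 2 / Mnorm M m)) m).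
    assert (Pr : 0 < r / 2 / Mnorm M m) by (apply Rdiv_lt_0_compat; lra).
    assert (Nxi : Mnorm M xi = r / 2).
    { unfold xi. rewrite Mnorm_scalR, Rabs_pos_eq by lra. field. lra. }
    assert (Txi : 2 * (INR n + 1) <= anorm (F xi k)).
    { unfold xi. rewrite FZ, anorm_scal, Rabs_pos_eq by lra.
      replace (2 * (INR n + 1))
        with (r / 2 / Mnorm M m * (4 * (INR n + 1) / r * Mnorm M m)) by (field; lra).
      apply Rmult_le_compat_l; lra. }
    (* The values of [F _ k] at [x] and [x + xi] differ by at least [2 (n + 1)], so one of them has
       norm at least [n + 1]. *)
    assert (C1 : exists x' : M, Mnorm M (hminus x' x) <= r / 2 /\ INR n + 1 <= anorm (F x' k)).
    { destruct (Rle_or_lt (INR n + 1) (anorm (F x k))) as [L|L].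
      - exists x. split; [|easy]. replace (hminus x x) with (hzero : M) by hring.
        rewrite Mnorm0. lra.
      - exists (hplus x xi). split.
        + replace (hminus (hplus x xi) x) with xi by hring. lra.
        + pose proof (anormD (F (hplus x xi) k) (aopp (F x k))) as T.
          rewrite anormN, FD in T.
          replace (aplus (aplus (F x k) (F xi k)) (aopp (F x k))) with (F xi k) in T by aring.
          rewrite FD. lra. }
    destruct C1 as [x' [Hx' Hn]].
    destruct (dual_bound _ (HG k)) as [c [Hc Bc]].
    assert (Pc : 0 < / (c + 1)) by (apply Rinv_0_lt_compat; lra).
    (* Radius [r / 2] keeps the new ball inside the old one; radius [1 / (c + 1)] keeps the
       variation of [F _ k] on it below 1. *)
    exists (x', Rmin (r / 2) (/ (c + 1))). intros _. simpl.
    pose proof (Rmin_l (r / 2) (/ (c + 1))). pose proof (Rmin_r (r / 2) (/ (c + 1))).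
    split; [apply Rmin_case; lra|split; [lra|split; [lra|]]].
    exists k. split; [easy|]. intros y Hy.
    specialize (Bc (hminus y x')). simpl in Bc. rewrite anorm_cstar, FB in Bc.
    pose proof (anormD (F y k) (aminus (F x' k) (F y k))) as T.
    replace (aplus (F y k) (aminus (F x' k) (F y k))) with (F x' k) in T by aring.
    rewrite anorm_minus_sym in T.
    assert (c * Mnorm M (hminus y x') <= 1).
    { apply Rle_trans with (c * / (c + 1)); [apply Rmult_le_compat_l; lra|].
      apply Rmult_le_reg_r with (c + 1); [lra|]. rewrite Rmult_assoc, Rinv_l; lra. }
    lra. }
  destruct (functional_choice _ step) as [nxt Hnxt].
  set (st := fix st (n : nat) : M * R :=
    match n with O => (hzero, 1) | S n => nxt (st n, n) end).
  assert (Pos : forall n : nat, 0 < snd (st n)).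
  { intro n. induction n as [|n IH]; simpl; [lra|]. now apply (Hnxt (st n, n)). }
  assert (HS : forall n : nat, Mnorm M (hminus (fst (st (S n))) (fst (st n))) + snd (st (S n)) <= snd (st n)
     /\ snd (st (S n)) <= snd (st n) / 2 /\ exists k, Mnorm M k <= 1 /\
      forall y, Mnorm M (hminus y (fst (st (S n)))) <= snd (st (S n)) -> INR n <= anorm (F y k)).
  { intro n. apply (Hnxt (st n, n)). apply Pos. }
  assert (Rad : forall n : nat, snd (st n) <= (/ 2) ^ n).
  { intro n. induction n as [|n IH]; [simpl; lra|].
    destruct (HS n) as [_ [L _]]. simpl pow. lra. }
  assert (Nest : forall n j : nat, Mnorm M (hminus (fst (st (n + j)%nat)) (fst (st n)))
      + snd (st (n + j)%nat) <= snd (st n)).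
  { intros n j. induction j as [|j IH].
    - rewrite Nat.add_0_r. replace (hminus (fst (st n)) (fst (st n))) with (hzero : M) by hring.
      rewrite Mnorm0. lra.
    - rewrite Nat.add_succ_r. destruct (HS (n + j)%nat) as [L _].
      pose proof (Mnorm_minus_triangle (fst (st (S (n + j)))) (fst (st n)) (fst (st (n + j)%nat))).
      lra. }
  destruct (hm_complete A M (fun n : nat => fst (st n))) as [l Hl].
  { intros eps He.
    destruct (pow_lt_1_zero (/ 2)) with (y := eps / 2) as [n0 Hn0]; [rewrite Rabs_pos_eq; lra|lra|].
    exists n0. intros p q Hp Hq. change (Mnorm M (hminus (fst (st p)) (fst (st q))) < eps).
    specialize (Hn0 n0 (le_n _)). rewrite Rabs_pos_eq in Hn0 by (apply pow_le; lra).
    pose proof (Nest n0 (p - n0)%nat) as Np. pose proof (Nest n0 (q - n0)%nat) as Nq.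
    replace (n0 + (p - n0))%nat with p in Np by lia.
    replace (n0 + (q - n0))%nat with q in Nq by lia.
    pose proof (Mnorm_minus_triangle (fst (st p)) (fst (st q)) (fst (st n0))) as T.
    rewrite (Mnorm_minus_sym (fst (st n0))) in T.
    pose proof (Pos p). pose proof (Pos q). pose proof (Rad n0). lra. }
  assert (Lim : forall n : nat, Mnorm M (hminus l (fst (st n))) <= snd (st n)).
  { intro n. apply le_epsilon. intros e He. destruct (Hl e He) as [N0 HN0].
    specialize (HN0 (n + N0)%nat ltac:(lia)).
    change (Mnorm M (hminus (fst (st (n + N0)%nat)) l) < e) in HN0.
    rewrite Mnorm_minus_sym in HN0. pose proof (Nest n N0). pose proof (Pos (n + N0)%nat).
    pose proof (Mnorm_minus_triangle l (fst (st n)) (fst (st (n + N0)%nat))). lra. }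
  destruct (dual_bound _ (HF l)) as [c [Hc Bc]].
  destruct (INR_unbounded c) as [n Hn].
  destruct (HS n) as [_ [_ [k [Hk Hy]]]]. specialize (Hy l (Lim (S n))).
  specialize (Bc k). pose proof (Mnorm_ge0 k). nra.
Qed.

End Dual.

(** * The submodule [M_J] *)

Section MJ.
Context {A : CstarAlgebra} (J : A -> Prop) (HJ : closed_ideal A J) {M : HilbertModule A}.
Implicit Types m n k l : M.
Implicit Types a b x : A.

Lemma MJspan_ind (P : M -> Prop) :
  P hzero -> (forall m x s, J x -> MJspan J M s -> P s -> P (hplus (ract M m x) s)) ->
  forall m, MJspan J M m -> P m.
Proof.
  intros H0 HS m [l [Hl ->]]. induction l as [|[n x] l IH]; [exact H0|].
  inversion Hl as [|? ? Hx Hl']; subst. apply HS; [easy| |now apply IH].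
  now exists l.
Qed.

Lemma MJspan0 : MJspan J M hzero.
Proof. exists nil. now split. Qed.

Lemma MJspan_cons m x s : J x -> MJspan J M s -> MJspan J M (hplus (ract M m x) s).
Proof.
  intros Hx [l [Hl ->]]. exists ((m, x) :: l). split; [|reflexivity]. now constructor.
Qed.

Lemma MJspan_act m x : J x -> MJspan J M (ract M m x).
Proof.
  intro Hx. replace (ract M m x) with (hplus (ract M m x) hzero) by hring.
  apply MJspan_cons; [easy|apply MJspan0].
Qed.

Lemma MJspan_plus m n : MJspan J M m -> MJspan J M n -> MJspan J M (hplus m n).
Proof.
  intros Hm Hn. revert m Hm. apply MJspan_ind.
  - now replace (hplus hzero n) with n by hring.
  - intros m x s Hx _ IH.
    replace (hplus (hplus (ract M m x) s) n) with (hplus (ract M m x) (hplus s n)) by hring.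
    now apply MJspan_cons.
Qed.

Lemma MJspan_scal (c : C) m : MJspan J M m -> MJspan J M (hscal c m).
Proof.
  revert m. apply MJspan_ind.
  - replace (hscal c hzero) with (hzero : M); [apply MJspan0|].
    apply ip_ext. intro k. rewrite ipZr, ip0r. unfold ascal, azero.
    symmetry. exact (scal_zero_r (V := A) c).
  - intros m x s Hx _ IH.
    replace (hscal c (hplus (ract M m x) s))
      with (hplus (ract M m (ascal c x)) (hscal c s)).
    + apply MJspan_cons; [now apply idealZ|easy].
    + apply ip_ext. intro k. now rewrite ipZr, !ipDr, ascalDr, ipZr, !ip_actr, acmulZr.
Qed.

Lemma MJspan_MJ m : MJspan J M m -> MJ J M m.
Proof.
  intros Hm e He. exists m. split; [easy|].
  change (Mnorm M (hminus m m) < e). replace (hminus m m) with (hzero : M) by hring.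
  now rewrite Mnorm0.
Qed.

Lemma MJ_approx m eps : MJ J M m -> 0 < eps ->
  exists m', MJspan J M m' /\ Mnorm M (hminus m m') < eps.
Proof. intros H. apply H. Qed.

Lemma MJ_closed m :
  (forall eps, 0 < eps -> exists m', MJ J M m' /\ Mnorm M (hminus m m') < eps) -> MJ J M m.
Proof.
  intros H e He. destruct (H (e / 2)) as [m' [Hm' N]]; [lra|].
  destruct (MJ_approx m' (e / 2) Hm') as [m'' [Hm'' N']]; [lra|].
  exists m''. split; [easy|]. change (Mnorm M (hminus m m'') < e).
  pose proof (Mnorm_minus_triangle m m'' m'). lra.
Qed.

Lemma MJ_act m x : J x -> MJ J M (ract M m x).
Proof. intro. now apply MJspan_MJ, MJspan_act. Qed.

Lemma MJ0 : MJ J M hzero.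
Proof. apply MJspan_MJ, MJspan0. Qed.

Lemma MJ_plus m n : MJ J M m -> MJ J M n -> MJ J M (hplus m n).
Proof.
  intros Hm Hn e He.
  destruct (MJ_approx m (e / 2) Hm) as [m' [Hm' N]]; [lra|].
  destruct (MJ_approx n (e / 2) Hn) as [n' [Hn' N']]; [lra|].
  exists (hplus m' n'). split; [now apply MJspan_plus|].
  change (Mnorm M (hminus (hplus m n) (hplus m' n')) < e).
  replace (hminus (hplus m n) (hplus m' n')) with (hplus (hminus m m') (hminus n n')) by hring.
  eapply Rle_lt_trans; [apply Mnorm_triangle|]. lra.
Qed.

Lemma MJ_scal (c : C) m : MJ J M m -> MJ J M (hscal c m).
Proof.
  intros Hm e He. pose proof (Cmod_ge_0 c).
  destruct (MJ_approx m (e / (Cmod c + 1)) Hm) as [m' [Hm' N]]; [apply Rdiv_lt_0_compat; lra|].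
  exists (hscal c m'). split; [now apply MJspan_scal|].
  change (Mnorm M (hminus (hscal c m) (hscal c m')) < e).
  replace (hminus (hscal c m) (hscal c m')) with (hscal c (hminus m m')).
  - eapply Rle_lt_trans; [apply Mnorm_scal|]. pose proof (Mnorm_ge0 (hminus m m')).
    apply Rle_lt_trans with (Cmod c * (e / (Cmod c + 1))); [nra|].
    apply Rmult_lt_reg_r with (Cmod c + 1); [lra|]. field_simplify; lra.
  - apply ip_ext. intro k. rewrite ipBr, !ipZr, ipBr.
    change (ascal c (aplus (ip M k m) (aopp (ip M k m')))
      = aplus (ascal c (ip M k m)) (aopp (ascal c (ip M k m')))).
    rewrite ascalDr, <- !ascalN1, !ascalA. do 2 f_equal. ring.
Qed.

Lemma MJ_minus m n : MJ J M m -> MJ J M n -> MJ J M (hminus m n).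
Proof. intros. rewrite hminusE. apply MJ_plus; [easy|now apply MJ_scal]. Qed.

(* If [x] is nearly [x e] with [e] in [J], then [n] is nearly [n e]. *)
Lemma dual_act_MJ (f : M -> A) x n : in_Mdual M f -> J x ->
  (forall k, cmul A (f k) x = ip M k n) -> MJ J M n.
Proof.
  intros Hf Hx Hn. destruct (dual_bound f Hf) as [c [Hc Bc]].
  apply MJ_closed. intros eps He.
  destruct (approx_unit J HJ x (eps / (c + 1)) Hx) as [e [Je [_ Ne]]];
    [apply Rdiv_lt_0_compat; lra|].
  exists (ract M n e). split; [now apply MJ_act|].
  set (d := anorm (aminus x (cmul A x e))) in *.
  assert (D0 : 0 <= d) by apply anorm_ge0.
  apply Rle_lt_trans with (c * d).
  - apply Mnorm_le_dual; [nra|]. intro k. rewrite ipBr, ip_actr, <- Hn, cmul_assoc, <- acmulBr.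
    eapply Rle_trans; [apply anorm_cmul|]. fold d. pose proof (Bc k). nra.
  - apply Rle_lt_trans with (c * (eps / (c + 1))); [nra|].
    apply Rmult_lt_reg_r with (c + 1); [lra|]. field_simplify; lra.
Qed.

(** On the span [F] is represented because [F (m x) = F m x]. The norm of [M] is the dual norm, so
    the bound on [F] makes the representing element a Lipschitz function of [m]. Representatives of
    approximants therefore form a Cauchy sequence, whose limit represents [F m]. *)
Lemma sesquilinear_MJ (F : M -> M -> A) :
  (forall m, in_Mdual M (F m)) ->
  (forall k, in_Mdual M (fun m => cstar A (F m k))) ->
  (forall m x, J x -> exists n, forall k, cmul A (F m k) x = ip M k n) ->
  forall m, MJ J M m -> exists n, MJ J M n /\ forall k, F m k = ip M k n.
Proof.
  intros HF HG Hx.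
  destruct (separately_bounded F HF HG) as [c [Hc Bc]].
  pose proof (fun m n k => flip_dualD F m n k (HG k)) as FD.
  pose proof (fun r m k => flip_dualZR F r m k (HG k)) as FZ.
  pose proof (fun m n k => flip_dualB F m n k (HG k)) as FB.
  pose proof (fun m x k => flip_dual_act F m x k (HG k)) as Fact.
  assert (span : forall s, MJspan J M s -> exists n, MJ J M n /\ forall k, F s k = ip M k n).
  { apply MJspan_ind.
    - exists hzero. split; [apply MJ0|]. intro k.
      rewrite <- (hscal0 hzero) at 1. rewrite FZ, ascal0. now rewrite ip0r.
    - intros m x s Jx _ [n [Hn En]]. destruct (Hx m x Jx) as [n' En'].
      exists (hplus n' n). split.
      + apply MJ_plus; [|easy]. now apply (dual_act_MJ (F m) x).
      + intro k. now rewrite FD, Fact, En, En', ipDr. }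
  intros m Hm.
  assert (seq : forall j : nat, exists p : M * M, Mnorm M (hminus m (fst p)) < / (INR j + 1) /\
    MJ J M (snd p) /\ forall k, F (fst p) k = ip M k (snd p)).
  { intro j. destruct (MJ_approx m (/ (INR j + 1)) Hm) as [m' [Hm' N]].
    - apply Rinv_0_lt_compat. pose proof (pos_INR j). lra.
    - destruct (span m' Hm') as [n [Hn En]]. now exists (m', n). }
  destruct (functional_choice _ seq) as [u Hu].
  assert (tail : forall eps, 0 < eps -> exists N, forall j, (N <= j)%nat ->
    Mnorm M (hminus m (fst (u j))) < eps).
  { intros e He. destruct (INR_unbounded (/ e)) as [N HN]. exists N. intros j Hj.
    eapply Rlt_trans; [apply Hu|]. apply le_INR in Hj. rewrite <- (Rinv_inv e).
    pose proof (Rinv_0_lt_compat e He). apply Rinv_lt_contravar; nra. }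
  assert (Lip : forall p q, Mnorm M (hminus (snd (u p)) (snd (u q)))
     <= c * Mnorm M (hminus (fst (u p)) (fst (u q)))).
  { intros p q. apply Mnorm_le_dual; [pose proof (Mnorm_ge0 (hminus (fst (u p)) (fst (u q)))); nra|].
    intro k. rewrite ipBr.
    destruct (Hu p) as [_ [_ <-]]. destruct (Hu q) as [_ [_ <-]]. rewrite <- FB. apply Bc. }
  assert (Small : forall e, 0 < e -> 0 < e / (c + 1) /\ c * (e / (c + 1)) < e).
  { intros e He. split; [apply Rdiv_lt_0_compat; lra|].
    apply Rmult_lt_reg_r with (c + 1); [lra|]. field_simplify; lra. }
  destruct (hm_complete A M (fun j => snd (u j))) as [l Hl].
  { intros e He. destruct (Small (e / 2)) as [S1 S2]; [lra|].
    destruct (tail (e / 2 / (c + 1))) as [N HN]; [easy|].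
    exists N. intros p q Hp Hq.
    change (Mnorm M (hminus (snd (u p)) (snd (u q))) < e).
    eapply Rle_lt_trans; [apply Lip|].
    pose proof (Mnorm_minus_triangle (fst (u p)) (fst (u q)) m) as T.
    rewrite (Mnorm_minus_sym (fst (u p)) m) in T.
    specialize (HN p Hp) as Np. specialize (HN q Hq). nra. }
  change (forall eps, 0 < eps -> exists N, forall p, (N <= p)%nat ->
    Mnorm M (hminus (snd (u p)) l) < eps) in Hl.
  exists l. split.
  - apply MJ_closed. intros e He. destruct (Hl e He) as [N HN].
    exists (snd (u N)). split; [apply Hu|]. rewrite Mnorm_minus_sym. now apply HN.
  - intro k. apply aminus_eq0, anorm_small. intros e He. pose proof (Mnorm_ge0 k).
    set (e' := e / 2 / (Mnorm M k + 1)).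
    assert (He' : 0 < e') by (unfold e'; apply Rdiv_lt_0_compat; lra).
    assert (Ek : e' * Mnorm M k <= e / 2).
    { unfold e'. apply Rmult_le_reg_r with (Mnorm M k + 1); [lra|]. field_simplify; nra. }
    destruct (Small e' He') as [S1 S2].
    destruct (tail _ S1) as [N HN]. destruct (Hl e' He') as [N' HN'].
    specialize (HN (N + N')%nat ltac:(lia)). specialize (HN' (N + N')%nat ltac:(lia)).
    destruct (Hu (N + N')%nat) as [_ [_ E]]. set (j := (N + N')%nat) in *.
    rewrite (aminus_trans _ _ (F (fst (u j)) k)). rewrite E at 2. rewrite <- FB, <- ipBr.
    eapply Rle_trans; [apply anormD|].
    pose proof (Bc (hminus m (fst (u j))) k) as B1.
    pose proof (cauchy_schwarz (hminus (snd (u j)) l) k) as B2.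
    assert (c * Mnorm M (hminus m (fst (u j))) <= e') by nra.
    assert (c * Mnorm M (hminus m (fst (u j))) * Mnorm M k <= e' * Mnorm M k) by nra.
    assert (Mnorm M k * Mnorm M (hminus (snd (u j)) l) <= e' * Mnorm M k) by nra.
    lra.
Qed.

End MJ.

Lemma Lub_Rbar_le (E : R -> Prop) (L : Rbar) :
  (forall r, E r -> Rbar_le r L) -> Rbar_le (Lub_Rbar E) L.
Proof. intro H. apply (proj2 (Lub_Rbar_correct E)). exact H. Qed.

(** Bounds a number by a supremum without deciding whether the supremum is finite: [p_infty] is
    immediate, a finite supremum is itself an admissible [s], and the nonnegative member excludes
    [m_infty]. *)
Lemma le_Lub_Rbar (E : R -> Prop) (r : R) :
  (exists r0, E r0 /\ 0 <= r0) ->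
  (forall s, 0 <= s -> (forall r', E r' -> r' <= s) -> r <= s) ->
  Rbar_le r (Lub_Rbar E).
Proof.
  intros [r0 [Er0 P0]] H. pose proof (proj1 (Lub_Rbar_correct E)) as ub.
  pose proof (ub _ Er0) as U0.
  destruct (Lub_Rbar E) as [s| |]; simpl in *; [|easy|easy].
  apply H; [lra|]. intros r' Er'. exact (ub _ Er').
Qed.

(** * Restriction to [M_J] *)

Section Restriction.
Context {A : CstarAlgebra} (J : A -> Prop) (HE : essential_ideal A J) (M : HilbertModule A).
Implicit Types m n k l : M.
Implicit Types a b x : A.
Implicit Types f g : M -> A.

Let HJ : closed_ideal A J := proj1 HE.

Lemma MJ_eq m n : MJ J M m -> MJ J M n ->
  (forall k, MJ J M k -> ip M k m = ip M k n) -> m = n.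
Proof.
  intros Hm Hn H. apply hminus_eq0, (ip_definite A M).
  change (ip M (hminus m n) (hminus m n) = azero).
  rewrite ipBr, H, aminus_diag; [easy|]. now apply MJ_minus.
Qed.

Lemma essential_eq a b : (forall x, J x -> cmul A a x = cmul A b x) -> a = b.
Proof.
  intro H. apply aminus_eq0, (essential0 J HE). intros x Hx.
  now rewrite acmulBl, H, aminus_diag.
Qed.

(** From [f (k x) = x^* f k] with [k x] in [M_J], agreement on [M_J] gives [f(k)^* x = g(k)^* x] for
    all [x] in [J]. *)
Lemma dual_eq f g : in_Mdual M f -> in_Mdual M g ->
  (forall k, MJ J M k -> f k = g k) -> forall k, f k = g k.
Proof.
  intros Hf Hg H k. rewrite <- (cstar_invol A (f k)), <- (cstar_invol A (g k)). f_equal.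
  apply essential_eq. intros x Hx.
  specialize (H (ract M k x) (MJ_act J k x Hx)).
  rewrite !dual_act in H by easy.
  rewrite <- (cstar_invol A x), <- !cstar_cmul. now f_equal.
Qed.

Section Bounded.
Context (T : M -> M) (HT : BM M T).

Lemma BM_plus m n : T (hplus m n) = hplus (T m) (T n).
Proof. apply HT. Qed.
Lemma BM_scal (c : C) m : T (hscal c m) = hscal c (T m).
Proof. apply HT. Qed.
Lemma BM_act m a : T (ract M m a) = ract M (T m) a.
Proof. apply HT. Qed.
Lemma BM_bound : exists c, 0 <= c /\ forall m, Mnorm M (T m) <= c * Mnorm M m.
Proof.
  destruct HT as (_ & _ & _ & c & H). exists (Rabs c). split; [apply Rabs_pos|].
  intro m. eapply Rle_trans; [apply H|]. pose proof (Mnorm_ge0 m).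
  pose proof (Rle_abs c). nra.
Qed.

Lemma BM_dual n : in_Mdual M (fun k => ip M (T k) n).
Proof.
  split; [|split; [|split]].
  - intros m m'. change (ip M (T (hplus m m')) n = aplus (ip M (T m) n) (ip M (T m') n)).
    now rewrite BM_plus, ipDl.
  - intros c m. change (ip M (T (hscal c m)) n = ascal (Cconj c) (ip M (T m) n)).
    now rewrite BM_scal, ipZl.
  - intros m a. now rewrite BM_act, ip_actl.
  - destruct BM_bound as [c [Hc Bc]]. exists (c * Mnorm M n). intro m.
    eapply Rle_trans; [apply cauchy_schwarz|].
    pose proof (Bc m). pose proof (Mnorm_ge0 n). nra.
Qed.

Lemma BM_MJ m : MJ J M m -> MJ J M (T m).
Proof.
  intro Hm. destruct BM_bound as [c [Hc Bc]].
  assert (span : forall s, MJspan J M s -> MJ J M (T s)).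
  { apply MJspan_ind.
    - rewrite <- (hscal0 hzero), BM_scal, hscal0. apply MJ0.
    - intros n x s Hx _ IH. rewrite BM_plus, BM_act.
      apply MJ_plus; [now apply MJ_act|easy]. }
  apply MJ_closed. intros e He.
  destruct (MJ_approx J m (e / (c + 1)) Hm) as [m' [Hm' N]]; [apply Rdiv_lt_0_compat; lra|].
  exists (T m'). split; [now apply span|].
  replace (hminus (T m) (T m')) with (T (hminus m m'))
    by (rewrite !hminusE, BM_plus, BM_scal; easy).
  eapply Rle_lt_trans; [apply Bc|]. pose proof (Mnorm_ge0 (hminus m m')).
  apply Rle_lt_trans with (c * (e / (c + 1))); [nra|].
  apply Rmult_lt_reg_r with (c + 1); [lra|]. field_simplify; lra.
Qed.

End Bounded.

Lemma BJ_restricts T : BJ J M T -> restrictsB J M T T /\ adjointable_on_MJ J M T.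
Proof.
  intros [HT Hadj]. split.
  - intros m Hm. split; [now apply BM_MJ|easy].
  - assert (H : forall m, exists n, MJ J M m ->
      MJ J M n /\ forall k, ip M (T k) m = ip M k n).
    { intro m. destruct (classic (MJ J M m)) as [Hm|]; [|now exists m].
      destruct (sesquilinear_MJ J HJ (fun n k => ip M (T k) n)) with (m := m) as [n Hn];
        [| | |easy|now exists n].
      - intro n. now apply BM_dual.
      - intro k. replace (fun n => cstar A (ip M (T k) n)) with (hat M (T k)).
        + apply hat_dual.
        + apply functional_extensionality. intro n. apply ipC.
      - intros n x Hx. now apply Hadj. }
    destruct (functional_choice _ H) as [Ts HTs].
    exists Ts. split.
    + intros m Hm. now apply HTs.
    + intros k l Hk Hl. rewrite (ipC l (Ts k)), (ipC (T l) k). f_equal.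
      symmetry. now apply (HTs k).
Qed.

(** Write [<T m, T m> = b^* b]. For [x] in the unit ball of [J], [m x] is in the unit ball of [M_J]
    and [<T (m x), T (m x)> = (b x)^* (b x)]. Since [J] is norming, these elements already detect
    [|b| = |T m|]. *)
Lemma BJ_opnorm T S : BJ J M T -> restrictsB J M T S ->
  opnorm_on M (MJ J M) S = opnorm_on M (fun _ => True) T.
Proof.
  intros [HT _] HS. unfold opnorm_on. apply Rbar_le_antisym; apply Lub_Rbar_le.
  - intros r [m [Hm [Nm ->]]]. apply (proj1 (Lub_Rbar_correct _)).
    exists m. split; [easy|split; [easy|]]. now rewrite (proj2 (HS m Hm)).
  - intros r [m [_ [Nm ->]]]. apply le_Lub_Rbar.
    + exists (Mnorm M (S hzero)). split; [|apply Mnorm_ge0].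
      exists hzero. split; [apply MJ0|split; [rewrite Mnorm0; lra|easy]].
    + intros s Hs ub. destruct (ip_pos A M (T m)) as [b Hb].
      assert (Nb : anorm b <= s).
      { apply (essential_norm_le J); [easy|easy|]. intros x Hx Nx.
        assert (L : Mnorm M (T (ract M m x)) <= s).
        { apply ub. exists (ract M m x). split; [now apply MJ_act|split].
          - eapply Rle_trans; [apply Mnorm_act|].
            pose proof (Mnorm_ge0 m). pose proof (anorm_ge0 x). nra.
          - now rewrite (proj2 (HS (ract M m x) (MJ_act J m x Hx))). }
        assert (E : anorm (cmul A b x) * anorm (cmul A b x)
           = Mnorm M (T (ract M m x)) * Mnorm M (T (ract M m x))).
        { rewrite Mnorm_sq, BM_act, ip_actr, ip_actl, Hb, <- anorm_cstar_id by easy.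
          f_equal. aring. }
        pose proof (anorm_ge0 (cmul A b x)). pose proof (Mnorm_ge0 (T (ract M m x))). nra. }
      apply Mnorm_le; [easy|]. rewrite Hb, anorm_cstar_id.
      pose proof (anorm_ge0 b). nra.
Qed.

(** [<k, T m> x = <k, T (m x)>] depends only on the restriction, and essentiality cancels [x]. *)
Lemma BJ_restriction_inj T1 T2 S1 S2 : BJ J M T1 -> BJ J M T2 ->
  restrictsB J M T1 S1 -> restrictsB J M T2 S2 ->
  (forall m, MJ J M m -> S1 m = S2 m) -> T1 = T2.
Proof.
  intros [H1 _] [H2 _] R1 R2 HS. apply functional_extensionality. intro m.
  apply ip_ext. intro k. apply essential_eq. intros x Hx.
  rewrite <- !ip_actr, <- !BM_act by easy. f_equal.
  pose proof (MJ_act J m x Hx) as Hm.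
  rewrite <- (proj2 (R1 _ Hm)), <- (proj2 (R2 _ Hm)). now apply HS.
Qed.

Lemma restrictsB_hom T1 T2 S1 S2 : restrictsB J M T1 S1 -> restrictsB J M T2 S2 ->
  restrictsB J M (fun m => T1 (T2 m)) (fun m => S1 (S2 m)) /\
  restrictsB J M (opadd M T1 T2) (opadd M S1 S2) /\
  (forall k : C, restrictsB J M (opscal M k T1) (opscal M k S1)).
Proof.
  intros R1 R2. split; [|split; [|intro c]]; intros m Hm;
    destruct (R1 m Hm) as [J1 E1]; destruct (R2 m Hm) as [J2 E2].
  - destruct (R1 _ J2) as [J3 E3]. split; [easy|]. now rewrite E3, E2.
  - unfold opadd. rewrite <- E1, <- E2. split; [|easy].
    exact (MJ_plus J (S1 m) (S2 m) J1 J2).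
  - unfold opscal. rewrite <- E1. split; [|easy]. exact (MJ_scal J HJ c (S1 m) J1).
Qed.

(** * The module [M^J] and its adjointable operators *)

Lemma ipJ_hat_l k f : in_Mdual M f -> ipJ_is J M (hat M k) f (f k).
Proof.
  intros Hf x Hx m1 m2 H1 H2. split.
  - unfold hat. now rewrite H1, <- ipC.
  - replace m2 with (ract M k (cstar A x)); [now rewrite dual_act, cstar_invol|].
    apply ip_ext. intro k'. now rewrite ip_actr, <- H2.
Qed.

Lemma ipJ_hat_r f k : in_Mdual M f -> ipJ_is J M f (hat M k) (cstar A (f k)).
Proof.
  intros Hf x Hx m1 m2 H1 H2. split.
  - replace m1 with (ract M k x); [now rewrite dual_act, cstar_cmul, cstar_invol|].
    apply ip_ext. intro k'. now rewrite ip_actr, <- H1.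
  - unfold hat. now rewrite ipC, <- H2, cstar_cmul, cstar_invol.
Qed.

Lemma ipJ_unique g f a b : M1 J M g -> M1 J M f ->
  ipJ_is J M g f a -> ipJ_is J M g f b -> a = b.
Proof.
  intros [_ Hg] [_ Hf] Ha Hb. apply essential_eq. intros x Hx.
  destruct (Hf x Hx) as [m1 H1]. destruct (Hg _ (ideal_star J HJ x Hx)) as [m2 H2].
  rewrite (proj1 (Ha x Hx m1 m2 H1 H2)). symmetry. apply (Hb x Hx m1 m2 H1 H2).
Qed.

Lemma hat_M1 m : M1 J M (hat M m).
Proof.
  split; [apply hat_dual|]. intros x Hx. exists (ract M m x). intro k.
  symmetry. apply ip_actr.
Qed.

Lemma hat_MupJ m : MupJ J M (hat M m).
Proof.
  split; [apply hat_M1|]. intros g Hg. exists (cstar A (g m)). apply ipJ_hat_r, Hg.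
Qed.

Lemma MupJ_M1 f : MupJ J M f -> M1 J M f.
Proof. intro H. apply H. Qed.
Lemma MupJ_dual f : MupJ J M f -> in_Mdual M f.
Proof. intro H. apply H. Qed.
Local Hint Resolve hat_MupJ hat_M1 hat_dual MupJ_M1 MupJ_dual : core.

(** The hypotheses are symmetric in [R] and [Rs], so this serves both for the operator and for its
    adjoint. The latter supplies the regularity of [R (hat m) k] in [m]. *)
Lemma hat_restrict_MJ (R Rs : (M -> A) -> (M -> A)) :
  (forall f, MupJ J M f -> MupJ J M (R f)) ->
  (forall f, MupJ J M f -> MupJ J M (Rs f)) ->
  (forall m k, R (hat M m) k = cstar A (Rs (hat M k) m)) ->
  forall m, MJ J M m -> exists n, MJ J M n /\ R (hat M m) = hat M n.
Proof.
  intros HR HRs H m Hm.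
  destruct (sesquilinear_MJ J HJ (fun m k => R (hat M m) k)) with (m := m) as [n [Hn En]];
    [| | |easy|].
  - intro n. auto.
  - intro k. replace (fun n => cstar A (R (hat M n) k)) with (Rs (hat M k)); [auto|].
    apply functional_extensionality. intro n. now rewrite H, cstar_invol.
  - intros n x Hx. assert (H1 : M1 J M (R (hat M n))) by auto. now apply H1.
  - exists n. split; [easy|]. now apply functional_extensionality.
Qed.

(** Pairing with [hat k] is evaluation at [k]. Hence [R f k = <hat k, R f> = <Rs (hat k), f>], and
    for [k] in [M_J] the functional [Rs (hat k)] is [hat (Ss k)], which leaves [f (Ss k)]. Thus
    [R f] on [M_J] is controlled by an operator of [M_J], for every [f] in [M^J]. *)
Lemma adjointable_MupJ_restricts R : adjointable_MupJ J M R ->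
  (forall m, MJ J M m -> exists n, MJ J M n /\ R (hat M m) = hat M n) /\
  exists Ss : M -> M, forall k, MJ J M k ->
    MJ J M (Ss k) /\ forall f, MupJ J M f -> R f k = f (Ss k).
Proof.
  intros [HR [Rs [HRs Hadj]]].
  assert (H : forall m k, R (hat M m) k = cstar A (Rs (hat M k) m)).
  { intros m k. apply (ipJ_unique (Rs (hat M k)) (hat M m)); auto.
    - apply Hadj; auto. apply ipJ_hat_l; auto.
    - apply ipJ_hat_r; auto. }
  assert (H' : forall m k, Rs (hat M m) k = cstar A (R (hat M k) m)).
  { intros. now rewrite H, cstar_invol. }
  split; [now apply (hat_restrict_MJ R Rs)|].
  assert (C : forall k, exists n, MJ J M k -> MJ J M n /\ forall f, MupJ J M f -> R f k = f n).
  { intro k. destruct (classic (MJ J M k)) as [Hk|]; [|now exists k].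
    destruct (hat_restrict_MJ Rs R HRs HR H' k Hk) as [n [Hn En]].
    exists n. intros _. split; [easy|]. intros f Hf.
    apply (ipJ_unique (hat M n) f); auto.
    - rewrite <- En. apply Hadj; auto. apply ipJ_hat_l; auto.
    - apply ipJ_hat_l; auto. }
  destruct (functional_choice _ C) as [Ss HSs]. now exists Ss.
Qed.

Lemma adjointable_MupJ_restriction R : adjointable_MupJ J M R ->
  exists S, restrictsUp J M R S /\ adjointable_on_MJ J M S.
Proof.
  intro HR. destruct (adjointable_MupJ_restricts R HR) as [H [Ss HSs]].
  assert (C : forall m, exists n, MJ J M m -> MJ J M n /\ R (hat M m) = hat M n).
  { intro m. destruct (classic (MJ J M m)) as [Hm|]; [|now exists m].
    destruct (H m Hm) as [n Hn]. now exists n. }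
  destruct (functional_choice _ C) as [S HS]. exists S. split; [exact HS|].
  exists Ss. split; [intros m Hm; now apply HSs|].
  intros k l Hk Hl. change (hat M l (Ss k) = hat M (S l) k).
  rewrite <- (proj2 (HS l Hl)). symmetry. now apply HSs.
Qed.

Lemma MupJ_opnorm R S : adjointable_MupJ J M R -> restrictsUp J M R S ->
  opnorm_on M (MJ J M) S = opnorm_MupJ J M R.
Proof.
  intros HR HS. unfold opnorm_on, opnorm_MupJ.
  apply Rbar_le_antisym; apply Lub_Rbar_le.
  - intros r [m [Hm [Nm ->]]]. apply (proj1 (Lub_Rbar_correct _)).
    destruct (HS m Hm) as [JS ES].
    exists (hat M m), (ip M m m), (ip M (S m) (S m)). rewrite ES.
    split; [apply hat_MupJ|split; [|split; [exact Nm|split; [|easy]]]].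
    + apply (ipJ_hat_l m (hat M m)); auto.
    + apply (ipJ_hat_l (S m) (hat M (S m))); auto.
  - intros r (f & a & b & Hf & Ha & Na & Hb & ->). apply le_Lub_Rbar.
    + exists (Mnorm M (S hzero)). split; [|apply Mnorm_ge0].
      exists hzero. split; [apply MJ0|split; [rewrite Mnorm0; lra|easy]].
    + intros s Hs ub. change (norm a) with (anorm a) in Na. change (norm b) with (anorm b).
      destruct (adjointable_MupJ_restricts R HR) as [_ [Ss HSs]].
      destruct HR as [HR _].
      assert (HRf : MupJ J M (R f)) by auto.
      assert (Na' : anorm a <= 1).
      { pose proof (sqrt_sqrt _ (anorm_ge0 a)). pose proof (sqrt_pos (anorm a)). nra. }
      (* Here [f x] is an element [m] of [M_J] with [<m, m> = x^* a x], so of norm at most 1, and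
         [n = (R f) x] turns out to be [S m]. *)
      assert (key : forall x, J x -> anorm x <= 1 -> exists n,
        (forall k, cmul A (R f k) x = ip M k n) /\ Mnorm M n <= s).
      { intros x Hx Nx.
        destruct (proj2 (MupJ_M1 f Hf) x Hx) as [m Hm].
        destruct (proj2 (MupJ_M1 f Hf) _ (ideal_star J HJ x Hx)) as [m2 Hm2].
        destruct (proj2 (MupJ_M1 _ HRf) x Hx) as [n Hn].
        assert (Jm : MJ J M m) by (apply (dual_act_MJ J HJ f x); auto).
        assert (Jn : MJ J M n) by (apply (dual_act_MJ J HJ (R f) x); auto).
        exists n. split; [easy|].
        (* Against [k] in [M_J]: [<k, S m> = <Ss k, m> = f (Ss k) x = (R f k) x = <k, n>]. *)
        assert (En : S m = n).
        { apply MJ_eq; [now apply HS|easy|]. intros k Hk.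
          change (hat M (S m) k = ip M k n). rewrite <- (proj2 (HS m Jm)).
          rewrite (proj2 (HSs k Hk)) by auto. unfold hat.
          rewrite <- Hm, <- Hn. f_equal. symmetry. now apply HSs. }
        rewrite <- En. apply ub. exists m. split; [easy|split; [|easy]].
        apply Mnorm_le; [lra|]. rewrite <- Hm.
        pose proof (proj1 (Ha x Hx m m2 Hm Hm2)) as E.
        rewrite <- (cstar_invol A (f m)), <- E.
        eapply Rle_trans; [apply anorm_cmul|]. rewrite anorm_cstar.
        pose proof (anorm_cmul a x). pose proof (anorm_ge0 a). pose proof (anorm_ge0 x).
        assert (anorm a * anorm x <= 1) by nra. nra. }
      (* [ipJ_is] does not exhibit [b] as a square, so [|b x|] is bounded by pairing two elements
         [(R f) x] and [(R f) y] instead. *)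
      assert (Nb : anorm b <= s * s).
      { apply (essential_norm_le J); [easy|nra|]. intros x Hx Nx.
        destruct (key x Hx Nx) as [n [Hn Nn]].
        set (c := cmul A b x).
        assert (Jc : J c) by now apply idealMl.
        assert (Ec : cstar A c = R f n).
        { destruct (proj2 (MupJ_M1 _ HRf) _ (ideal_star J HJ x Hx)) as [m2 Hm2].
          unfold c. rewrite (proj1 (Hb x Hx n m2 Hn Hm2)). apply cstar_invol. }
        destruct (anorm_ge0 c) as [P|P]; [|nra].
        (* With [n = (R f) x] and [n' = (R f) y], [<n, n'> = (R f n) y = c^* c / |c|], whose norm is
           [|c|]. *)
        set (y := ascal (RtoC (/ anorm c)) c).
        assert (Ny : anorm y <= 1).
        { unfold y. rewrite anorm_scal, Rabs_inv, Rabs_pos_eq, Rinv_l; lra. }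
        destruct (key y) as [n' [Hn' Nn']]; [now apply idealZ|easy|].
        assert (E : anorm c = anorm (ip M n n')).
        { rewrite <- Hn', <- Ec. unfold y.
          rewrite acmulZr, anorm_scal, anorm_cstar_id, Rabs_inv, Rabs_pos_eq by lra.
          field. lra. }
        rewrite E. eapply Rle_trans; [apply cauchy_schwarz|].
        pose proof (Mnorm_ge0 n). pose proof (Mnorm_ge0 n'). nra. }
      rewrite <- (sqrt_square s) by easy. now apply sqrt_le_1_alt.
Qed.

(** Equal restrictions have equal adjoints on [M_J]. These determine [R f] on [M_J], and a
    functional is determined by its values there. *)
Lemma MupJ_restriction_inj R1 R2 S1 S2 :
  adjointable_MupJ J M R1 -> adjointable_MupJ J M R2 ->
  restrictsUp J M R1 S1 -> restrictsUp J M R2 S2 ->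
  (forall m, MJ J M m -> S1 m = S2 m) ->
  forall f, MupJ J M f -> R1 f = R2 f.
Proof.
  intros H1 H2 HS1 HS2 HS f Hf. apply functional_extensionality.
  destruct (adjointable_MupJ_restricts R1 H1) as [_ [Ss1 HSs1]].
  destruct (adjointable_MupJ_restricts R2 H2) as [_ [Ss2 HSs2]].
  apply dual_eq; [apply MupJ_dual, H1, Hf|apply MupJ_dual, H2, Hf|].
  intros k Hk. destruct (HSs1 k Hk) as [J1 E1]. destruct (HSs2 k Hk) as [J2 E2].
  rewrite E1, E2 by easy. f_equal. apply MJ_eq; [easy|easy|]. intros l Hl.
  rewrite (ipC (Ss1 k) l), (ipC (Ss2 k) l). f_equal.
  change (hat M l (Ss1 k) = hat M l (Ss2 k)). rewrite <- E1, <- E2 by auto.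
  now rewrite (proj2 (HS1 l Hl)), (proj2 (HS2 l Hl)), HS.
Qed.

Lemma restrictsUp_hom R1 R2 S1 S2 : restrictsUp J M R1 S1 -> restrictsUp J M R2 S2 ->
  restrictsUp J M (fun f => R1 (R2 f)) (fun m => S1 (S2 m)) /\
  restrictsUp J M (upadd M R1 R2) (opadd M S1 S2) /\
  (forall k : C, restrictsUp J M (upscal M k R1) (opscal M k S1)).
Proof.
  intros H1 H2. split; [|split; [|intro c]]; intros m Hm;
    destruct (H1 m Hm) as [J1 E1]; destruct (H2 m Hm) as [J2 E2].
  - destruct (H1 _ J2) as [J3 E3]. split; [easy|]. now rewrite E2, E3.
  - split; [exact (MJ_plus J (S1 m) (S2 m) J1 J2)|].
    unfold upadd. rewrite E1, E2. apply functional_extensionality. intro k.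
    symmetry. apply ipDr.
  - split; [exact (MJ_scal J HJ c (S1 m) J1)|].
    unfold upscal. rewrite E1. apply functional_extensionality. intro k.
    symmetry. apply ipZr.
Qed.

End Restriction.

Theorem theorem3p6 (A : CstarAlgebra) (J : A -> Prop) (M : HilbertModule A) :
  essential_ideal A J ->
  (* underline-alpha : B_J(M) -> B^*(M_J), T |-> T|_{M_J} *)
  ((forall T, BJ J M T -> exists S, restrictsB J M T S /\ adjointable_on_MJ J M S) /\
   (forall T S, BJ J M T -> restrictsB J M T S ->
      opnorm_on M (MJ J M) S = opnorm_on M (fun _ => True) T) /\
   (forall T1 T2 S1 S2, BJ J M T1 -> BJ J M T2 ->
      restrictsB J M T1 S1 -> restrictsB J M T2 S2 ->
      (forall m, MJ J M m -> S1 m = S2 m) -> T1 = T2) /\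
   (forall T1 T2 S1 S2, BJ J M T1 -> BJ J M T2 ->
      restrictsB J M T1 S1 -> restrictsB J M T2 S2 ->
      restrictsB J M (fun m => T1 (T2 m)) (fun m => S1 (S2 m)) /\
      restrictsB J M (opadd M T1 T2) (opadd M S1 S2) /\
      (forall k : C, restrictsB J M (opscal M k T1) (opscal M k S1)))) /\
  (* alpha : B^*(M^J) -> B^*(M_J), R |-> R|_{M_J} *)
  ((forall R, adjointable_MupJ J M R ->
      exists S, restrictsUp J M R S /\ adjointable_on_MJ J M S) /\
   (forall R S, adjointable_MupJ J M R -> restrictsUp J M R S ->
      opnorm_on M (MJ J M) S = opnorm_MupJ J M R) /\
   (forall R1 R2 S1 S2, adjointable_MupJ J M R1 -> adjointable_MupJ J M R2 ->
      restrictsUp J M R1 S1 -> restrictsUp J M R2 S2 ->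
      (forall m, MJ J M m -> S1 m = S2 m) ->
      forall f, MupJ J M f -> R1 f = R2 f) /\
   (forall R1 R2 S1 S2, adjointable_MupJ J M R1 -> adjointable_MupJ J M R2 ->
      restrictsUp J M R1 S1 -> restrictsUp J M R2 S2 ->
      restrictsUp J M (fun f => R1 (R2 f)) (fun m => S1 (S2 m)) /\
      restrictsUp J M (upadd M R1 R2) (opadd M S1 S2) /\
      (forall k : C, restrictsUp J M (upscal M k R1) (opscal M k S1)))).
Proof.
  intro HE. split; [split; [|split; [|split]]|split; [|split; [|split]]].
  - intros T HT. exists T. now apply BJ_restricts.
  - intros T S. now apply BJ_opnorm.
  - intros T1 T2 S1 S2. now apply BJ_restriction_inj.
  - intros T1 T2 S1 S2 _ _. now apply restrictsB_hom.
  - now apply adjointable_MupJ_restriction.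
  - intros R S. now apply MupJ_opnorm.
  - intros R1 R2 S1 S2. now apply MupJ_restriction_inj.
  - intros R1 R2 S1 S2 _ _. now apply restrictsUp_hom.
Qed.
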